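(* Let $\mathcal H$ be a normalized hypergraph on a finite set $V$ with $\operatorname{rank}(\mathcal H)\le 2$. The connected components of $G_{\mathcal H}$ and their forced status can be computed in $O(L(\mathcal H))$ time using $O(L(\mathcal H))$ working space. Let $C_1,\dots,C_q$ be the unforced components. All coatoms of $\operatorname{Mod}(\Phi_{\mathcal H})$ can then be enumerated exactly once as follows. If a coatom is output through its sparse complement $C_i$, the delay is $\Theta(|C_i|+1)$ and the total running time is $$O\Bigl(L(\mathcal H)+\sum_{i=1}^{q}(|C_i|+1)\Bigr).$$ If coatoms are output as $|V|$-bit characteristic vectors, the delay is $\Theta(|V|)$ and the total running time is $O(L(\mathcal H)+q|V|)$. The same bounds hold when outputs are ordered by nondecreasing complement size.
   Context: A hypergraph on a finite set $V$ is a family $\mathcal H\subseteq 2^V$, given by its incidence list; it is normalized if it has no repeated incidences, no duplicate hyperedges and no empty hyperedge. Put $L(\mathcal H)=|V|+|\mathcal H|+\sum_{A\in\mathcal H}|A|$ and $\operatorname{rank}(\mathcal H)=\max_{A\in\mathcal H}|A|$ (zero if $\mathcal H$ is empty). The associated definite Horn CNF is $\Phi_{\mathcal H}=\bigwedge_{A\in\mathcal H}\bigwedge_{v\in A}\bigl((A\setminus\{v\})\to v\bigr)$, with model family $\operatorname{Mod}(\Phi_{\mathcal H})\subseteq 2^V$ (models identified with sets of true variables). A coatom is an inclusion-maximal member of $\operatorname{Mod}(\Phi_{\mathcal H})\setminus\{V\}$; its complement is its complement in $V$. For $\operatorname{rank}(\mathcal H)\le2$, $G_{\mathcal H}$ is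 the graph on $V$ whose edges are the two-element hyperedges of $\mathcal H$ (its components include isolated vertices). A connected component is called forced if it contains a vertex $v$ with $\{v\}\in\mathcal H$, and unforced otherwise. The delay is the time spent for each output after the preprocessing (computation of the components and their forced status); the time needed to write an output is included. *)

(* Defs.v *)
From mathcomp Require Import all_boot.

Set Implicit Arguments.
Unset Strict Implicit.
Unset Printing Implicit Defensive.

(* A hypergraph is given by its incidence list [H : seq (seq V)]; the family
   itself is [edges H]. *)

Section Hypergraph.
Variables (V : finType) (H : seq (seq V)).

Definition edges : {set {set V}} := [set:: [seq [set x in A] | A <- H]].

Definition normalized : bool :=
  [&& all uniq H, uniq [seq [set x in A] | A <- H] & [::] \notin H].

Definition input_size : nat := #|V| + #|edges| + \sum_(A in edges) #|A|.

Definition rank : nat := \max_(A in edges) #|A|.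

(* The pair [(B, v)] is the definite Horn clause [B -> v]. *)
Definition horn_cnf : {set {set V} * V} :=
  [set (A :\ v, v) | A in edges, v in A].

Definition graph : rel V := fun u v => (u != v) && ([set u; v] \in edges).

Definition components : {set {set V}} :=
  equivalence_partition (connect graph) [set: V].

Definition forced (C : {set V}) : bool := [exists v in C, [set v] \in edges].

Definition unforced_components : {set {set V}} :=
  [set C in components | ~~ forced C].

End Hypergraph.

Definition models (V : finType) (F : {set {set V} * V}) : {set {set V}} :=
  [set S : {set V} | [forall cl in F, (cl.1 \subset S) ==> (cl.2 \in S)]].

Definition coatoms (V : finType) (F : {set {set V} * V}) : {set {set V}} :=
  [set M | maxset (fun X => X \in models F :\ [set: V]) M].

(* Random-access machine with structured control.  A program is a fixed
   command using finitely many registers, and a memory addressed by computed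
   words.  [Emit] appends one word to the output being written, and [Flush]
   terminates that output. *)

Inductive expr : Type :=
| Cst of nat
| Reg of nat
| Read of expr
| Add of expr & expr
| Sub of expr & expr.

Inductive cmd : Type :=
| Skip
| Assign of nat & expr
| Write of expr & expr
| Seq of cmd & cmd
| If of expr & cmd & cmd
| While of expr & cmd
| Emit of expr
| Flush.

(* [outs] holds the completed outputs in chronological order, each with the
   clock value at its completion; [pending] is the unfinished one. *)
Record state : Type := State {
  regs : nat -> nat;
  mem : nat -> nat;
  clock : nat;
  pending : seq nat;
  outs : seq (nat * seq nat) }.

Section Semantics.
(* Words range over [0, W) and usable addresses over [0, S); a computation
   leaving these ranges is stuck, so [S] bounds the working space, input
   included. *)
Variables W S : nat.

Definition word (n : nat) : option nat := if n < W then Some n else None.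

Fixpoint eval (s : state) (e : expr) : option nat :=
  match e with
  | Cst n => word n
  | Reg x => Some (regs s x)
  | Read e1 =>
      if eval s e1 is Some a then if a < S then Some (mem s a) else None
      else None
  | Add e1 e2 =>
      if eval s e1 is Some m then
        if eval s e2 is Some n then word (m + n) else None
      else None
  | Sub e1 e2 =>
      if eval s e1 is Some m then
        if eval s e2 is Some n then word (m - n) else None
      else None
  end.

Fixpoint cost (e : expr) : nat :=
  match e with
  | Cst _ | Reg _ => 1
  | Read e1 => (cost e1).+1
  | Add e1 e2 | Sub e1 e2 => (cost e1 + cost e2).+1
  end.

Definition tick (t : nat) (s : state) : state :=
  State (regs s) (mem s) (clock s + t) (pending s) (outs s).

Definition set_reg (x v : nat) (s : state) : state :=
  State [eta regs s with x |-> v] (mem s) (clock s) (pending s) (outs s).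

Definition set_mem (a v : nat) (s : state) : state :=
  State (regs s) [eta mem s with a |-> v] (clock s) (pending s) (outs s).

Definition emit (v : nat) (s : state) : state :=
  State (regs s) (mem s) (clock s) (rcons (pending s) v) (outs s).

Definition flush (s : state) : state :=
  State (regs s) (mem s) (clock s) [::]
    (rcons (outs s) (clock s, pending s)).

Inductive exec : cmd -> state -> state -> Prop :=
| ExSkip s : exec Skip s (tick 1 s)
| ExAssign x e s v : eval s e = Some v ->
    exec (Assign x e) s (set_reg x v (tick (cost e).+1 s))
| ExWrite e1 e2 s a v : eval s e1 = Some a -> a < S -> eval s e2 = Some v ->
    exec (Write e1 e2) s (set_mem a v (tick (cost e1 + cost e2).+1 s))
| ExSeq c1 c2 s s1 s2 : exec c1 s s1 -> exec c2 s1 s2 ->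
    exec (Seq c1 c2) s s2
| ExIf e c1 c2 s v s1 : eval s e = Some v ->
    exec (if v != 0 then c1 else c2) (tick (cost e).+1 s) s1 ->
    exec (If e c1 c2) s s1
| ExWhileStop e c s : eval s e = Some 0 ->
    exec (While e c) s (tick (cost e).+1 s)
| ExWhileStep e c s v s1 s2 : eval s e = Some v -> v != 0 ->
    exec c (tick (cost e).+1 s) s1 -> exec (While e c) s1 s2 ->
    exec (While e c) s s2
| ExEmit e s v : eval s e = Some v ->
    exec (Emit e) s (emit v (tick (cost e).+1 s))
| ExFlush s : exec Flush s (flush (tick 1 s)).

End Semantics.

Section Enumeration.
Variables (V : finType) (H : seq (seq V)).

Definition encode : seq nat :=
  [:: #|V|; size H] ++
  flatten [seq size A :: [seq val (enum_rank v) | v <- A] | A <- H].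

Definition init_state : state :=
  State (fun=> 0) (nth 0 encode) 0 [::] [::].

(* Words of [O(log L)] bits. *)
Definition word_bound (k : nat) : nat := (input_size H).+2 ^ k.

(* Register 0 points to an array labelling each vertex by the index of its
   component, register 1 to an array of flags indexed by those labels, and
   register 2 holds the number of components. *)
Definition components_computed (s : state) : Prop :=
  let label v := mem s (regs s 0 + enum_rank v) in
  [/\ regs s 2 = #|components H|,
      forall v, label v < regs s 2,
      forall u v, (label u == label v) = connect (graph H) u v
    & forall C v, C \in components H -> v \in C ->
        (mem s (regs s 1 + label v) != 0) = forced H C].

Inductive mode : Type := SparseComplement | CharVector.

Definition represents (m : mode) (M : {set V}) (w : seq nat) : bool :=
  match m with
  | SparseComplement => perm_eq w [seq val (enum_rank v) | v <- enum (~: M)]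
  | CharVector => w == [seq nat_of_bool (v \in M) | v <- enum V]
  end.

Definition delay_order (m : mode) (M : {set V}) : nat :=
  match m with
  | SparseComplement => #|~: M| + 1
  | CharVector => #|V|
  end.

Definition total_order (m : mode) : nat :=
  match m with
  | SparseComplement =>
      input_size H + \sum_(C in unforced_components H) (#|C| + 1)
  | CharVector => input_size H + #|unforced_components H| * #|V|
  end.

Definition delays (t0 : nat) (ts : seq nat) : seq nat :=
  pairmap (fun a b => b - a) t0 ts.

Definition theta (c f t : nat) : bool := (f <= c * t) && (t <= c * f).

(* [s1] is the state after preprocessing, [s2] the final one; [ms] lists the
   coatoms in the order of output.  The successor in the total time only
   matters for the empty instance, whose size is 0. *)
Definition enumerated (m : mode) (by_size : bool) (c : nat) (s1 s2 : state) :
    Prop :=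
  exists ms : seq {set V},
    [/\ uniq ms /\ ms =i coatoms (horn_cnf H),
        by_size ==> sorted leq [seq #|~: M| | M <- ms],
        all2 (represents m) ms [seq o.2 | o <- outs s2] /\ pending s2 = [::],
        all2 (fun M d => theta c (delay_order m M) d) ms
          (delays (clock s1) [seq o.1 | o <- outs s2])
      & clock s2 <= c * (total_order m).+1].

End Enumeration.

(* Main.v *)
Require Import Defs.
From mathcomp Require Import all_boot zify.
Import Defs.

(** The clauses coming from a hyperedge [{u, w}] say that [u] and [w] are true
together, and those coming from [{u}] that [u] is true.  A set is therefore a
model exactly when it is a union of components of the graph that includes every
forced one ([modelP]), and a maximal proper model omits exactly one unforced
component ([coatoms_unforced]).  Enumerating coatoms thus amounts to
enumerating unforced components.

The program is a classical linear time one.  A search labels the vertices by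
components.  It is written as one loop whose turns advance along an arc, take
the next queued vertex or try the next root, so that one invariant ([explored])
and one potential, counting the untraversed arcs, the vertices not yet taken
from the queue and the untried roots, give both correctness and the linear
bound ([wp_search]).  Everything else is obtained by sorting into linked
buckets ([bucketize]): arcs by source give adjacency lists, vertices by label
give the members of each component, and components by size give an order of
nondecreasing size.  In that last sort a forced component is given size 0, and
the bucket 0 is skipped, which leaves an array of exactly the unforced
components, sorted ([buckets], [wp_collect]).

Because this array is sorted once and for all during the preprocessing, one
enumeration program serves both the ordered and the unordered variant.  Each
turn of its outer loop follows the bucket of a single component, or compares
every label with the label of that component, and does only a constant amount
of other work.  Its duration is thus the size of the output up to a constant
factor ([wp_emit_all], [emits_component], [emits_vector]).

Execution on the machine is partial and its memory is flat, so programs are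
first verified against states with separate arrays by a predicate
transformer [wp], in which every range condition is a proof obligation.  Array
[j] occupies the addresses from [j * T] on, with a common length
[T = |V| + 3 |H| + 2] that is large enough for each of them, and
[wp_sound] turns [wp] into an actual execution. *)

Set Implicit Arguments.
Unset Strict Implicit.
Unset Printing Implicit Defensive.

(** * Coatoms and unforced components *)
Section Coatoms.
Variables (V : finType) (H : seq (seq V)).

Lemma graph_sym : symmetric (graph H).
Proof. by move=> u v; rewrite /graph eq_sym setUC. Qed.

Lemma componentsP C :
  reflect (exists x, C = [set y | connect (graph H) x y]) (C \in components H).
Proof.
apply: (iffP imsetP) => [[x _ ->]|[x ->]]; exists x => //;
  by apply/setP=> y; rewrite !inE.
Qed.

Lemma component_connect C u v : C \in components H -> u \in C ->
  (v \in C) = connect (graph H) u v.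
Proof.
move=> /componentsP[x ->]; rewrite !inE => xu.
exact: (same_connect (sym_connect_sym graph_sym) xu).
Qed.

Hypothesis rank2 : rank H <= 2.

Lemma card_edge A : A \in edges H -> #|A| <= 2.
Proof. by move=> AH; apply: leq_trans rank2; apply: leq_bigmax_cond. Qed.

(** A path of binary clauses propagates truth along the graph, and a clause
of a hyperedge of size at most 2 has at most one premise, so nothing else is
imposed on a model. *)
Lemma modelP (S : {set V}) :
  reflect ((forall v, [set v] \in edges H -> v \in S) /\
           (forall u v, connect (graph H) u v -> u \in S -> v \in S))
    (S \in models (horn_cnf H)).
Proof.
rewrite inE; apply: (iffP forall_inP) => [mS|[units conn] cl].
  have step A v : A \in edges H -> v \in A -> A :\ v \subset S -> v \in S.
    move=> AH vA; apply/implyP; apply: (mS (A :\ v, v)).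
    by apply/imset2P; exists A v.
  split=> [v vH|u v /connectP[p + ->]].
    by apply: (step _ _ vH); rewrite ?set11 ?setDv ?sub0set.
  elim: p u => //= w p IH u /andP[/andP[uw uwH] wp] uS; apply: IH wp _.
  apply: step uwH (set22 u w) _; apply/subsetP=> x.
  by rewrite !inE => /andP[/negPf->]; rewrite orbF => /eqP->.
case/imset2P => A v AH vA -> /=; apply/implyP=> AS.
have : #|A :\ v| <= 1 by have := card_edge AH; rewrite (cardsD1 v A) vA.
rewrite leq_eqVlt ltnS leqn0 cards_eq0 => /orP[/cards1P[u uE]|/eqP A0].
  have uv : u != v by have := set11 u; rewrite -uE !inE => /andP[].
  apply: (conn u); last by apply: (subsetP AS); rewrite uE set11.
  by apply: connect1; rewrite /graph uv setUC -uE setD1K.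
by apply: units; rewrite -(setD1K vA) A0 setU0 in AH.
Qed.

(** A component is closed under connection in both directions, so its
complement is too, and the complement keeps all forced vertices as long as they
lie outside. *)
Lemma unforced_model C : C \in components H -> ~~ forced H C ->
  ~: C \in models (horn_cnf H).
Proof.
move=> CH nf; apply/modelP; split=> [v vH|u v uv].
  by rewrite inE; apply: contra nf => vC; apply/exists_inP; exists v.
rewrite !inE; apply: contra => vC.
by rewrite (component_connect _ CH vC) (sym_connect_sym graph_sym).
Qed.

(** A proper model misses some vertex, hence its whole component, which is
then unforced; the complement of that component is a model above the given one.
Conversely any model above the complement of a component [C] contains [C] as
soon as it meets [C]. *)
Lemma coatoms_unforced :
  coatoms (horn_cnf H) = [set ~: C | C in unforced_components H].
Proof.
apply/setP=> M; rewrite inE; apply/maxsetP/imsetP => [[]|[C]].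
  rewrite in_setD1 => /andP[MT mM] maxM; have /modelP[units conn] := mM.
  have /subsetPn[v _ vM] : ~~ (setT \subset M) by rewrite subTset.
  pose C := [set y | connect (graph H) v y].
  have CH : C \in components H by apply/componentsP; exists v.
  have vC : v \in C by rewrite inE connect0.
  have CM w : w \in C -> w \notin M.
    rewrite inE => vw; apply: contra vM; apply: conn.
    by rewrite (sym_connect_sym graph_sym).
  have nf : ~~ forced H C.
    by apply/exists_inP=> -[w /CM + /units]; move/negPf->.
  exists C; first by rewrite inE CH.
  rewrite (maxM (~: C)) //.
    rewrite in_setD1 unforced_model // andbT; apply/eqP=> E.
    by have := in_setT v; rewrite -E inE vC.
  by apply/subsetP=> w wM; rewrite inE; apply: contraL wM; apply: CM.
rewrite inE => /andP[CH nf] ->; split.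
  rewrite in_setD1 unforced_model // andbT; apply/eqP=> E.
  have /componentsP[x Cx] := CH.
  by have := in_setT x; rewrite -E inE Cx inE connect0.
move=> X; rewrite in_setD1 => /andP[XT /modelP[_ conn]] CX.
have /subsetPn[v _ vX] : ~~ (setT \subset X) by rewrite subTset.
have vC : v \in C by apply: contraR vX => vC; apply: (subsetP CX); rewrite inE.
apply/eqP; rewrite eqEsubset CX andbT; apply/subsetP=> w wX.
rewrite inE; apply: contra vX => wC; apply: conn wX.
by rewrite -(component_connect _ CH wC).
Qed.
End Coatoms.

(** * Programs over arrays: predicate transformer and refinement *)
(** Registers from 20 on hold the base addresses of the arrays; programs
never assign them after the setup.  The addition is the plain one, and
[array_index] below is unfolded to nested matches, so that both reduce when
[wp] is simplified on a concrete program. *)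
Definition array_reg (j : nat) : nat := Nat.add 20 j.

Fixpoint array_index_from (d x : nat) : option nat :=
  match d, x with
  | 0, _ => Some x
  | _.+1, 0 => None
  | d'.+1, x'.+1 => array_index_from d' x'
  end.

Definition array_index := Eval compute in array_index_from 20.

Lemma array_index_some x j : array_index x = Some j -> x = array_reg j.
Proof. by do 20 (case: x => [//|x]); case=> <-. Qed.

Lemma array_index_none x j : array_index x = None -> array_reg j != x.
Proof. by do 20 (case: x => [//|x]). Qed.

Definition get (j : nat) (e : expr) : expr := Read (Add (Reg (array_reg j)) e).
Definition put (j : nat) (e1 e2 : expr) : cmd :=
  Write (Add (Reg (array_reg j)) e1) e2.

Record astate : Type := AState {
  areg : nat -> nat;
  aarr : nat -> nat -> nat;
  aclock : nat;
  apending : seq nat;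
  aouts : seq (nat * seq nat) }.

(** The updates below match on the state instead of projecting its fields:
a state then occurs once in each update, so that long chains of updates stay
cheap to convert. *)
Definition atick (t : nat) (a : astate) : astate :=
  let: AState r m c p o := a in AState r m (c + t) p o.

Definition aset_reg (x v : nat) (a : astate) : astate :=
  let: AState r m c p o := a in AState [eta r with x |-> v] m c p o.

Definition aset_arr (j i v : nat) (a : astate) : astate :=
  let: AState r m c p o := a in
  AState r (fun j' => if j' == j
                      then fun i' => if i' == i then v else m j i'
                      else m j') c p o.

Definition aemit (v : nat) (a : astate) : astate :=
  let: AState r m c p o := a in AState r m c (rcons p v) o.

Definition aflush (a : astate) : astate :=
  let: AState r m c p o := a in AState r m c [::] (rcons o (c, p)).

(** The value of an expression whose memory accesses all have the form
[get j e]; other reads are given a dummy value here and rejected by [asafe]. *)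
Fixpoint aval (a : astate) (e : expr) : nat :=
  match e with
  | Cst n => n
  | Reg x => areg a x
  | Read (Add (Reg x) e1) =>
      if array_index x is Some j then aarr a j (aval a e1) else 0
  | Read _ => 0
  | Add e1 e2 => aval a e1 + aval a e2
  | Sub e1 e2 => aval a e1 - aval a e2
  end.

Section ArrayMachine.
Variables W S J T : nat.

(** The range conditions under which evaluation is not stuck: constants and
intermediate results fit in a word, and array indices are less than [T]. *)
Fixpoint asafe (a : astate) (e : expr) : Prop :=
  match e with
  | Cst n => n < W
  | Reg x => True
  | Read (Add (Reg x) e1) =>
      if array_index x is Some j then [/\ j < J, asafe a e1 & aval a e1 < T]
      else False
  | Read _ => False
  | Add e1 e2 => [/\ asafe a e1, asafe a e2 & aval a e1 + aval a e2 < W]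
  | Sub e1 e2 => [/\ asafe a e1, asafe a e2 & aval a e1 - aval a e2 < W]
  end.

(** A loop invariant with a variant, hence total correctness.  The body is
passed as a predicate transformer so that this can be a separate constant, which
simplification does not open. *)
Definition wp_loop (e : expr) (body : (astate -> Prop) -> astate -> Prop)
    (Q : astate -> Prop) (a : astate) : Prop :=
  exists (I : astate -> Prop) (mu : astate -> nat), I a /\
  forall b, I b -> asafe b e /\
    if aval b e != 0
    then body (fun b' => I b' /\ mu b' < mu b) (atick (cost e).+1 b)
    else Q (atick (cost e).+1 b).
Arguments wp_loop : simpl never.

Fixpoint wp (c : cmd) (Q : astate -> Prop) (a : astate) : Prop :=
  match c with
  | Skip => Q (atick 1 a)
  | Assign x e =>
      [/\ array_index x = None, asafe a e
        & Q (aset_reg x (aval a e) (atick (cost e).+1 a))]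
  | Write (Add (Reg x) e1) e2 =>
      if array_index x is Some j then
        [/\ [/\ j < J, asafe a e1 & aval a e1 < T], asafe a e2
          & Q (aset_arr j (aval a e1) (aval a e2)
                 (atick ((1 + cost e1).+1 + cost e2).+1 a))]
      else False
  | Write _ _ => False
  | Seq c1 c2 => wp c1 (wp c2 Q) a
  | If e c1 c2 =>
      asafe a e /\
      if aval a e != 0 then wp c1 Q (atick (cost e).+1 a)
      else wp c2 Q (atick (cost e).+1 a)
  | While e c1 => wp_loop e (fun R => wp c1 R) Q a
  | Emit e => asafe a e /\ Q (aemit (aval a e) (atick (cost e).+1 a))
  | Flush => Q (aflush (atick 1 a))
  end.

Lemma wp_seq c1 c2 Q a : wp (Seq c1 c2) Q a = wp c1 (wp c2 Q) a.
Proof. by []. Qed.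

Lemma wp_mono c (P Q : astate -> Prop) a :
  (forall b, P b -> Q b) -> wp c P a -> wp c Q a.
Proof.
elim: c P Q a => [|x e|e1 e2|c1 IH1 c2 IH2|e c1 IH1 c2 IH2|e c IH|e|] P Q a PQ /=.
- exact: PQ.
- by case=> ? ? /PQ.
- case: e1 => // -[] //= x e1; case: array_index => // j.
  by case=> ? ? /PQ.
- by apply: IH1 => b; apply: IH2.
- by case=> se; case: ifP => _ wpb; split=> //; [apply: IH1 wpb | apply: IH2 wpb].
- case=> I [mu [Ia inv]]; exists I, mu; split=> // b /inv[se H]; split=> //.
  by case: ifP H => // _; apply: PQ.
- by case=> se /PQ.
- exact: PQ.
Qed.

(** When each turn costs at most [K] steps and lowers the potential [mu],
the loop costs at most [K] times the initial potential. *)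
Lemma wp_while (I : astate -> Prop) (mu : astate -> nat) (K : nat) e c Q a :
    I a ->
    (forall b, I b -> asafe b e /\ (aval b e != 0 ->
       wp c (fun b' => [/\ I b', mu b' < mu b & aclock b' <= aclock b + K])
          (atick (cost e).+1 b))) ->
    (forall b, I b -> aval b e = 0 -> aclock b <= aclock a + K * mu a ->
       Q (atick (cost e).+1 b)) ->
  wp (While e c) Q a.
Proof.
move=> Ia step stop.
exists (fun b => I b /\ aclock b + K * mu b <= aclock a + K * mu a), mu.
split=> // b [Ib le_b]; have [se wpb] := step _ Ib; split=> //.
case: eqP => [z|/eqP nz] /=; first by apply: stop => //; lia.
apply: wp_mono (wpb nz) => b' [Ib' lt_mu le_b']; split=> //; split=> //.
have : K * (mu b').+1 <= K * mu b by rewrite leq_mul2l lt_mu orbT.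
by rewrite mulnS; lia.
Qed.

(** The base registers belong to the relation because programs address the
arrays through them. *)
Definition refines (a : astate) (s : state) : Prop :=
  [/\ regs s = areg a, clock s = aclock a,
      pending s = apending a /\ outs s = aouts a,
      forall j i, j < J -> i < T -> mem s (j * T + i) = aarr a j i
    & forall j, j < J -> areg a (array_reg j) = j * T].

Hypothesis (space : J * T <= S) (words : S <= W).

Lemma address_lt j i : j < J -> i < T -> j * T + i < S.
Proof.
move=> jJ iT; apply: leq_trans space.
by rewrite (leq_trans _ (leq_mul jJ (leqnn T))) // mulSn addnC ltn_add2r.
Qed.

Lemma address_eq j i j' i' : i < T -> i' < T ->
  (j * T + i == j' * T + i') = (j == j') && (i == i').
Proof.
move=> iT iT'; apply/eqP/andP => [E|[/eqP-> /eqP->] //].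
have T0 : 0 < T by lia.
have /eqP := congr1 (fun x => x %/ T) E.
rewrite !divnMDl // !divn_small // !addn0 => /eqP jj.
by move: E; rewrite jj => /addnI ->.
Qed.

Lemma eval_refines a s e :
  refines a s -> asafe a e -> eval W S s e = Some (aval a e).
Proof.
move=> [Er _ _ Em Eb].
elim: {e}_.+1 {-2}e (ltnSn (cost e)) => // N IH e le_eN.
case: e le_eN => [n|x|e|e1 e2|e1 e2] /= le_eN.
- by rewrite /word => ->.
- by rewrite Er.
- case: e le_eN => // -[] //= x e le_eN.
  case E: (array_index x) => [j|//] [jJ se lt_T].
  rewrite (IH e) //; last by lia.
  rewrite (array_index_some E) Er Eb // /word.
  have lt_S := address_lt jJ lt_T.
  by rewrite ifT ?lt_S ?Em //; lia.
- by case=> s1 s2 lt_W; rewrite !IH ?/word ?lt_W //; lia.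
- by case=> s1 s2 lt_W; rewrite !IH ?/word ?lt_W //; lia.
Qed.

Lemma refines_tick t a s : refines a s -> refines (atick t a) (tick t s).
Proof. by case: a => r m ck p o [/= E1 E2 E3 E4 E5]; split=> //=; rewrite E2. Qed.

Lemma refines_set_reg x v a s : array_index x = None -> refines a s ->
  refines (aset_reg x v a) (set_reg x v s).
Proof.
move=> xN; case: a => r m ck p o [/= E1 E2 E3 E4 E5]; split=> //=.
  by rewrite -E1.
by move=> j jJ; rewrite (negPf (array_index_none j xN)) E5.
Qed.

Lemma refines_set_mem j i v a s : j < J -> i < T -> refines a s ->
  refines (aset_arr j i v a) (set_mem (j * T + i) v s).
Proof.
move=> jJ iT; case: a => r m ck p o [/= E1 E2 E3 E4 E5]; split=> //=.
move=> j' i' jJ' iT'; rewrite address_eq //.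
by case: eqP => [->|_] /=; [case: eqP => // _; apply: E4 | apply: E4].
Qed.

Lemma refines_emit v a s : refines a s -> refines (aemit v a) (emit v s).
Proof.
by case: a => r m ck p o [/= E1 E2 [E3 E3'] E4 E5]; split=> //=; rewrite E3.
Qed.

Lemma refines_flush a s : refines a s -> refines (aflush a) (flush s).
Proof.
case: a => r m ck p o [/= E1 E2 [E3 E3'] E4 E5]; split=> //=.
by rewrite E2 E3 E3'.
Qed.

(** Total correctness: a program verified against array states runs to
completion on the machine. *)
Lemma wp_sound c Q a s : wp c Q a -> refines a s ->
  exists2 s', exec W S c s s' & exists2 a', refines a' s' & Q a'.
Proof.
elim: c Q a s => [|x e|e1 e2|c1 IH1 c2 IH2|e c1 IH1 c2 IH2|e c IH|e|] Q a s.
- move=> QA R; exists (tick 1 s); first by constructor.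
  by exists (atick 1 a) => //; apply: refines_tick.
- move=> /= [xN se QA] R; eexists; first by constructor; apply: eval_refines R se.
  by eexists; [apply: refines_set_reg xN (refines_tick _ R) | apply: QA].
- case: e1 => // -[] //= x e1; case E: (array_index x) => [j|//].
  move=> [[jJ s1 lt_T] s2 QA] R.
  have [Er _ _ _ Eb] := R.
  have lt_S := address_lt jJ lt_T.
  have ev : eval W S s (Add (Reg x) e1) = Some (j * T + aval a e1).
    rewrite /= (eval_refines R s1) Er (array_index_some E) Eb // /word ifT //.
    by lia.
  eexists; first by apply: ExWrite ev lt_S (eval_refines R s2).
  by eexists; [apply: refines_set_mem jJ lt_T (refines_tick _ R) | apply: QA].
- move=> /= wp1 R; have [s1 ex1 [a1 R1 wp2]] := IH1 _ _ _ wp1 R.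
  have [s2 ex2 [a2 R2 Q2]] := IH2 _ _ _ wp2 R1.
  by exists s2; [apply: ExSeq ex1 ex2 | exists a2].
- move=> /= [se wpb] R.
  have {IH1 IH2 wpb}[s2 ex2 [a2 R2 Q2]] : exists2 s',
      exec W S (if aval a e != 0 then c1 else c2) (tick (cost e).+1 s) s'
      & exists2 a', refines a' s' & Q a'.
    by case: ifP wpb => _ wpb; [apply: IH1 wpb _ | apply: IH2 wpb _];
      apply: refines_tick.
  by exists s2; [apply: ExIf (eval_refines R se) ex2 | exists a2].
- move=> /= [I [mu [Ia inv]]].
  elim: {a}_.+1 {-2}a (ltnSn (mu a)) s Ia => // N IHN a lt_N s Ia R.
  have [se] := inv _ Ia; case: ifP => nz.
    move=> wpb; have [s1 ex1 [a1 R1 [I1 lt_mu]]] := IH _ _ _ wpb (refines_tick _ R).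
    have [|s2 ex2 [a2 R2 Q2]] := IHN a1 _ s1 I1 R1; first by lia.
    by exists s2; [apply: ExWhileStep (eval_refines R se) nz ex1 ex2 | exists a2].
  move=> QA; eexists; last first.
    by exists (atick (cost e).+1 a); [apply: refines_tick R|].
  apply: ExWhileStop; rewrite (eval_refines R se); congr Some.
  by apply/eqP; rewrite -[_ == _]negbK nz.
- move=> /= [se QA] R; eexists; first by constructor; apply: eval_refines R se.
  by eexists; [apply: refines_emit (refines_tick _ R) | apply: QA].
- move=> QA R; eexists; first by constructor.
  by eexists; [apply: refines_flush (refines_tick _ R) | apply: QA].
Qed.

End ArrayMachine.

(** * Memory layout and loops *)

(** Scalar registers: the two pointers and the count that the result of the
preprocessing is read from, the numbers of vertices, hyperedges and arcs, the
common length of all arrays, and loop variables. *)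
Notation rLAB := 0 (only parsing).
Notation rFLAG := 1 (only parsing).
Notation rNumC := 2 (only parsing).
Notation rNumV := 3 (only parsing).
Notation rNumE := 4 (only parsing).
Notation rNumArcs := 5 (only parsing).
Notation rLength := 6 (only parsing).
Notation rIndex := 7 (only parsing).
Notation rPtr := 8 (only parsing).
Notation rRoot := 9 (only parsing).
Notation rHead := 10 (only parsing).
Notation rTail := 11 (only parsing).
Notation rArc := 12 (only parsing).
Notation rVertex := 13 (only parsing).
Notation rNumListed := 14 (only parsing).
Notation rComp := 15 (only parsing).

(** Arrays.  Array [IN] is the input.  [SRC] and [DST] hold the end points of
the arcs: a hyperedge [{u, w}] gives the two arcs [u -> w] and [w -> u], and a
singleton [{u}] gives two loops at [u].  The pairs [EHEAD]/[ENEXT],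
[VHEAD]/[VNEXT] and [CHEAD]/[CNEXT] are linked buckets of arcs by source, of
vertices by label and of components by size. *)
Notation IN := 0 (only parsing).
Notation LAB := 1 (only parsing).
Notation FLAG := 2 (only parsing).
Notation SRC := 3 (only parsing).
Notation DST := 4 (only parsing).
Notation EHEAD := 5 (only parsing).
Notation ENEXT := 6 (only parsing).
Notation VIS := 7 (only parsing).
Notation QUEUE := 8 (only parsing).
Notation VHEAD := 9 (only parsing).
Notation VNEXT := 10 (only parsing).
Notation SIZE := 11 (only parsing).
Notation CHEAD := 12 (only parsing).
Notation CNEXT := 13 (only parsing).
Notation LIST := 14 (only parsing).
Notation narrays := 15 (only parsing).

(** Everything but the listed arrays and registers is unchanged, the clock
excepted, and nothing is output. *)
Definition frame_on (arrays registers : seq nat) (a b : astate) : Prop :=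
  [/\ forall j, j \notin arrays -> aarr b j = aarr a j,
      forall x, x \notin registers -> areg b x = areg a x
    & apending b = apending a /\ aouts b = aouts a].

(** Splits the conjunctions produced by [wp] and discharges the range
conditions. *)
Ltac split_safe :=
  repeat match goal with
  | |- and3 _ _ _ => split
  | |- and4 _ _ _ _ => split
  | |- _ /\ _ => split
  end; try first [exact Logic.I | done | lia].

(** Proves that a register outside of a list of registers is unchanged. *)
Ltac frame := let z := fresh in let zl := fresh in
  move=> z zl; rewrite /=; move: (zl); rewrite !inE ?negb_or;
  do ?[case: eqP => //= _]; try by auto.

Definition incr (x : nat) : cmd := Assign x (Add (Reg x) (Cst 1)).

(** The bound is reread at each turn, so the body must not change it. *)
Definition for_loop (x bound : nat) (body : cmd) : cmd :=
  Seq (Assign x (Cst 0))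
    (While (Sub (Reg bound) (Reg x)) (Seq body (incr x))).

(** The invariant [I] is indexed by the number of completed turns; a time
bound, when needed, is made a part of [I]. *)
Lemma wp_for W J T (I : nat -> astate -> Prop) x bound body Q a :
    let N := areg a bound in
    N < W -> array_index x = None -> bound != x ->
    I 0 (aset_reg x 0 (atick 2 a)) ->
    (forall i b, i < N -> I i b -> areg b x = i -> areg b bound = N ->
       wp W J T (Seq body (incr x))
         (fun b' => [/\ I i.+1 b', areg b' x = i.+1 & areg b' bound = N])
         (atick 4 b)) ->
    (forall b, I N b -> Q (atick 4 b)) ->
  wp W J T (for_loop x bound body) Q a.
Proof.
case: a => r m ck p o N NW xN bx I0 step stop; rewrite /for_loop wp_seq; split=> //.
  by rewrite /=; lia.
exists (fun b => [/\ I (areg b x) b, areg b x <= N & areg b bound = N]).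
exists (fun b => N - areg b x); split.
  by split; rewrite /= ?eqxx ?(negPf bx).
move=> b [Ib le_N bN]; split; first by rewrite /=; split_safe.
case: ifP => nz.
  have lt_N : areg b x < N by move: nz; rewrite /= bN; lia.
  refine (wp_mono _ (step _ _ lt_N Ib erefl bN)).
  move=> b' [Ib' bx' bN']; split; last by rewrite bx'; lia.
  by split; rewrite ?bx'.
apply: stop; rewrite (_ : N = areg b x) //.
by move: nz; rewrite /= bN; lia.
Qed.

(** * Linked buckets *)

(** [prev key k i] is the head of the list of the indices [j < i] with
[key j = k], taken in decreasing order.  Pointers are shifted by one: [j.+1]
points to [j], and 0 is the null pointer.  The successor of [j] in its list is
[prev key (key j) j]. *)
Fixpoint prev (key : nat -> nat) (k i : nat) : nat :=
  if i is i'.+1 then if key i' == k then i else prev key k i' else 0.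

(** The list that starts at the pointer [prev key k p]. *)
Definition chain (key : nat -> nat) (k p : nat) : seq nat :=
  [seq j <- rev (iota 0 p) | key j == k].

Lemma chainS key k p :
  chain key k p.+1 = if key p == k then p :: chain key k p else chain key k p.
Proof. by rewrite /chain -addn1 iotaD rev_cat. Qed.

Lemma mem_chain key k p j : (j \in chain key k p) = (j < p) && (key j == k).
Proof. by rewrite mem_filter mem_rev mem_iota andbC. Qed.

Lemma chain_uniq key k p : uniq (chain key k p).
Proof. by rewrite filter_uniq // rev_uniq iota_uniq. Qed.

(** Following a pointer skips only indices with another key. *)
Lemma chain_prev key k p : chain key k (prev key k p) = chain key k p.
Proof.
elim: p => //= p IH; rewrite chainS; case: ifP => [kp|//].
by rewrite chainS kp.
Qed.

Lemma prev_le key k p : prev key k p <= p.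
Proof. by elim: p => //= p IH; case: ifP => //; lia. Qed.

Lemma prev_key key k p j : prev key k p = j.+1 -> key j = k.
Proof. by elim: p => //= p IH; case: eqP => // E [<-]. Qed.

Lemma prev_max key k p j : j < p -> key j = k -> j < prev key k p.
Proof.
elim: p => //= p IH jp kj; case: eqP => [//|ne].
apply: IH => //; rewrite ltnS leq_eqVlt in jp.
by case/orP: jp => // /eqP jp; case: ne; rewrite -jp.
Qed.

Definition bucketize (jk jh jn bound : nat) : cmd :=
  for_loop rIndex bound
    (Seq (put jn (Reg rIndex) (get jh (get jk (Reg rIndex))))
         (put jh (get jk (Reg rIndex)) (Add (Reg rIndex) (Cst 1)))).

(** After [i] insertions the heads are [prev key k i], and each link is
frozen when its index is inserted; no reasoning on the shape of linked lists is
needed. *)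
Lemma wp_bucketize W J T (key : nat -> nat) jk jh jn bound Q a :
    let M := areg a bound in
    [/\ jk < J, jh < J & jn < J] -> [/\ jk != jh, jk != jn & jh != jn] ->
    bound != rIndex -> M <= T -> T.+1 < W ->
    (forall i, i < M -> aarr a jk i = key i) ->
    (forall i, i < M -> key i < T) ->
    (forall k, k < T -> aarr a jh k = 0) ->
    (forall b,
       frame_on [:: jh; jn] [:: rIndex] a b ->
       (forall k, k < T -> aarr b jh k = prev key k M) ->
       (forall i, i < M -> aarr b jn i = prev key (key i) i) ->
       aclock b <= aclock a + 6 + 40 * M -> Q b) ->
  wp W J T (bucketize jk jh jn bound) Q a.
Proof.
case: a => rg ar ck pd os M [jkJ jhJ jnJ] [kh kn hn] b7 MT TW keyE keyT head0 post.
rewrite /= in M MT keyE keyT head0 post.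
pose I i b :=
  [/\ forall j, j != jh -> j != jn -> aarr b j = ar j,
      forall x, x != 7 -> areg b x = rg x,
      apending b = pd /\ aouts b = os,
      forall k, k < T -> aarr b jh k = prev key k i
    & (forall i', i' < i -> aarr b jn i' = prev key (key i') i') /\
      aclock b <= ck + 2 + 40 * i].
apply: (@wp_for _ _ _ I) => //; first by rewrite /=; lia.
- split=> //=; [by move=> x; case: eqP | by split=> //; lia].
- move=> i [rb ab kb pb ob] iM [/= Fa Fr Fo H [N le]] bi bM.
  rewrite /= in iM bi bM *; rewrite -/M in iM.
  have kE : ab jk i = key i by rewrite Fa // keyE.
  have := keyT i iM => kT.
  rewrite bi (negPf kn) kE.
  split_safe; last by rewrite (negPf b7).
  split=> //=.
  + by move=> j /negPf jh' /negPf jn'; rewrite jh' jn' Fa // ?jh' ?jn'.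
  + by move=> x /negPf x7; rewrite x7 Fr // x7.
  + move=> k lk; rewrite eqxx (negPf hn) addn1 eq_sym.
    by case: (key i == k) => //; apply: H.
  + split; last by lia.
    move=> i' lt_i; rewrite eqxx eq_sym (negPf hn) H //.
    by case: eqP => [->//|ne]; apply: N; lia.
- move=> [rb ab kb pb ob] [/= Fa Fr Fo H [N le]]; apply: post => //=; last by lia.
  split=> // [j|x]; rewrite !inE ?negb_or; last exact: Fr.
  by case/andP=> jh' jn'; apply: Fa.
Qed.

(** * Invariant of the graph search *)

Section Search.
Variables (n M : nat) (src dst : nat -> nat) (R : nat -> nat -> Prop).
Hypotheses
  (dst_lt : forall j, j < M -> dst j < n)
  (reverse : forall j, j < M ->
     exists j', [/\ j' < M, src j' = dst j & dst j' = src j])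
  (R_refl : forall x, R x x)
  (R_sym : forall x y, R x y -> R y x)
  (R_trans : forall x y z, R x y -> R y z -> R x z)
  (R_edge : forall j, j < M -> R (src j) (dst j)).

(** The search state: [d] are the vertices taken from the queue, [f] those
still queued, [lab] the labels of both, [r] the next root to try, [k] the number
of components met so far, and [e] a pointer into the adjacency list of the
vertex under exploration, which is the last one of [d].  Only the current
component, whose label is [k - 1], can have pending vertices or arcs.  The arcs
of an explored vertex have been traversed, except those of the last vertex whose
index is below [e]. *)
Record explored (d f : seq nat) (lab : nat -> nat) (r k e : nat) : Prop :=
  Explored {
    explored_uniq : uniq (d ++ f);
    explored_lt : {in d ++ f, forall x, x < n};
    explored_roots : r <= n /\ {subset iota 0 r <= d ++ f};
    explored_label : {in d ++ f, forall x, lab x < k};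
    explored_onto : forall c, c < k -> exists2 x, x \in d ++ f & lab x = c;
    explored_conn : {in d ++ f &, forall x y, lab x = lab y -> R x y};
    explored_front : {in f, forall x, (lab x).+1 = k};
    explored_edge : 0 < e ->
      [/\ e <= M, last 0 d \in d, src e.-1 = last 0 d
        & (lab (last 0 d)).+1 = k];
    explored_done : forall j, j < M -> src j \in d ->
      (src j = last 0 d -> e <= j) ->
      dst j \in d ++ f /\ lab (dst j) = lab (src j) }.

(** If the end [w] of the current arc is already visited, it belongs to the
current component: otherwise [w] is a finished vertex, and the reverse arc, which
has been traversed, would have given the current vertex the label of [w]. *)
Lemma explored_edge_label d f lab r k e : explored d f lab r k e.+1 ->
  dst e \in d ++ f -> lab (dst e) = lab (src e).
Proof.
move=> E; have [//|eM ud ue uk] := explored_edge E; rewrite /= in ue.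
rewrite mem_cat => /orP[wd|/(explored_front E) wk]; last by rewrite ue; lia.
have [j [jM sj dj]] := reverse eM.
have [->|wu] := eqVneq (dst e) (last 0 d); first by rewrite -ue.
have [|| _] := explored_done E jM; rewrite ?sj ?dj //.
by move/eqP; rewrite (negPf wu).
Qed.

(** Moving the pointer [e] past one arc marks no other arc as traversed,
because adjacency lists have no gaps. *)
Lemma done_step d f lab r k e j : explored d f lab r k e.+1 ->
  j < M -> src j \in d -> (src j = last 0 d -> prev src (src e) e <= j) ->
  j != e -> dst j \in d ++ f /\ lab (dst j) = lab (src j).
Proof.
move=> E jM sd old ne; apply: (explored_done E) => // su.
have [//|_ _ ue _] := explored_edge E; rewrite /= in ue.
have := old su; case: (ltnP j e) => [lt|]; last by rewrite leq_eqVlt eq_sym (negPf ne).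
by have := prev_max lt (etrans su (esym ue)); lia.
Qed.

Lemma edge_step d f lab r k e e' : explored d f lab r k e.+1 ->
  e' = prev src (src e) e -> 0 < e' ->
  [/\ e' <= M, last 0 d \in d, src e'.-1 = last 0 d
    & (lab (last 0 d)).+1 = k].
Proof.
move=> E; case: e' => // e' De _; have [//|eM ud ue uk] := explored_edge E.
split=> //=; first by have := prev_le src (src e) e; lia.
by rewrite (prev_key (esym De)).
Qed.

Lemma explored_old d f lab r k e : explored d f lab r k e.+1 ->
  dst e \in d ++ f -> explored d f lab r k (prev src (src e) e).
Proof.
move=> E wdf; have wl := explored_edge_label E wdf.
case: (E) => *; split=> //; first exact: edge_step E erefl.
move=> j jM sd old; have [->//|ne] := eqVneq j e.
exact: done_step E jM sd old ne.
Qed.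

Lemma explored_pop d y f lab r k : explored d (y :: f) lab r k 0 ->
  explored (rcons d y) f lab r k (prev src y M).
Proof.
move=> E; case: (E); rewrite -cat_rcons => Eu El Er Elab Eo Ec Ef Ee Ed.
split=> //; rewrite ?last_rcons.
- by move=> x xf; apply: Ef; rewrite inE xf orbT.
- case De: (prev _ _ _) => [//|e'] _; split.
  + by rewrite -De prev_le.
  + by rewrite mem_rcons mem_head.
  + exact: prev_key De.
  + by apply: Ef; rewrite mem_head.
- move=> j jM; rewrite mem_rcons inE => /orP[/eqP sj|sd] old.
    by have := prev_max jM sj; have := old sj; lia.
  by apply: Ed => //.
Qed.

Let relabel (lab : nat -> nat) w v x := if x == w then v else lab x.

Lemma explored_new d f lab r k e (w := dst e) : explored d f lab r k e.+1 ->
  w \notin d ++ f ->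
  explored d (rcons f w) (relabel lab w (k - 1)) r k (prev src (src e) e).
Proof.
move=> E wN; have [//|eM ud ue uk] := explored_edge E; rewrite /= in ue.
have k1 : (k - 1).+1 = k by lia.
have labE x : x \in d ++ f -> relabel lab w (k - 1) x = lab x.
  by move=> xdf; rewrite /relabel; case: eqP xdf wN => // -> ->.
have labw : relabel lab w (k - 1) w = k - 1 by rewrite /relabel eqxx.
have sub x : x \in d -> x \in d ++ f by rewrite mem_cat => ->.
(* all these vertices are related to the source of the current arc *)
have Rw x : x \in d ++ f -> lab x = k - 1 -> R x w.
  move=> xdf lx; apply: R_trans (R_edge eM); rewrite ue.
  by apply: (explored_conn E) => //; [apply: sub | lia].
case: (E) => Eu El [Er1 Er2] Elab Eo Ec Ef Ee Ed; split; rewrite -?rcons_cat.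
- by rewrite rcons_uniq wN.
- by move=> x; rewrite mem_rcons inE => /orP[/eqP->|/El //]; apply: dst_lt.
- by split=> // x /Er2; rewrite mem_rcons inE orbC => ->.
- move=> x; rewrite mem_rcons inE => /orP[/eqP->|xdf]; first by rewrite labw; lia.
  by rewrite labE // Elab.
- move=> c /Eo[x xdf lx]; exists x; last by rewrite labE.
  by rewrite mem_rcons inE xdf orbT.
- move=> x y; rewrite !mem_rcons !inE => /orP[/eqP->|xdf] /orP[/eqP->|ydf] //.
  + by rewrite labw labE // => /esym/(Rw _ ydf)/R_sym.
  + by rewrite labw labE // => /(Rw _ xdf).
  + by rewrite !labE //; apply: Ec.
- move=> x; rewrite mem_rcons inE => /orP[/eqP->|xf]; first by rewrite labw.
  by rewrite labE ?Ef // mem_cat xf orbT.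
- by move=> e'0; have [? ? ? ?] := edge_step E erefl e'0; rewrite labE ?sub.
- move=> j jM sd old; rewrite mem_rcons inE.
  have [->|ne] := eqVneq j e.
    by rewrite eqxx labw labE ?ue; [split=> //; lia | apply: sub].
  by have [df lE] := done_step E jM sd old ne; rewrite df orbT !labE ?(sub _ sd).
Qed.

Lemma explored_old_root d lab r k : explored d [::] lab r k 0 ->
  r < n -> r \in d -> explored d [::] lab r.+1 k 0.
Proof.
case=> Eu El [Er1 Er2] Elab Eo Ec Ef Ee Ed rn rd; split=> //; split=> // x.
rewrite mem_iota /= add0n ltnS leq_eqVlt => /orP[/eqP->|xr]; first by rewrite cats0.
by apply: Er2; rewrite mem_iota.
Qed.

Lemma explored_new_root d lab r k : explored d [::] lab r k 0 ->
  r < n -> r \notin d -> explored d [:: r] (relabel lab r k) r.+1 k.+1 0.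
Proof.
case; rewrite cats0 => Eu El [Er1 Er2] Elab Eo Ec Ef Ee Ed rn rNumV.
have labE x : x \in d -> relabel lab r k x = lab x.
  by move=> xdf; rewrite /relabel; case: eqP xdf rNumV => // -> ->.
have labr : relabel lab r k r = k by rewrite /relabel eqxx.
split; rewrite ?cats1.
- by rewrite rcons_uniq rNumV.
- by move=> x; rewrite mem_rcons inE => /orP[/eqP->|/El].
- split=> // x; rewrite mem_iota mem_rcons inE /= add0n ltnS leq_eqVlt.
  by case/orP=> [->//|xr]; rewrite Er2 ?orbT // mem_iota.
- move=> x; rewrite mem_rcons inE => /orP[/eqP->|xd]; first by rewrite labr.
  by rewrite labE // ltnW // ltnS Elab.
- move=> c; rewrite ltnS leq_eqVlt => /orP[/eqP->|/Eo[x xd lx]].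
    by exists r => //; rewrite mem_rcons mem_head.
  by exists x; rewrite ?labE // mem_rcons inE xd orbT.
- move=> x y; rewrite !mem_rcons !inE => /orP[/eqP->|xd] /orP[/eqP->|yd] //.
  + by rewrite labr labE // => E; have := Elab _ yd; rewrite -E ltnn.
  + by rewrite labr labE // => E; have := Elab _ xd; rewrite E ltnn.
  + by rewrite !labE //; apply: Ec.
- by move=> x; rewrite inE => /eqP->; rewrite labr.
- by [].
- move=> j jM sd _; have [//|dd lE] := Ed j jM sd.
  by rewrite mem_rcons inE dd orbT !labE.
Qed.

Definition degree x := size (chain src x M).

(** Each arc has one source, so it is counted at most once. *)
Lemma sum_degree_le d : uniq d -> \sum_(x <- d) degree x <= M.
Proof.
move=> d_uniq.
rewrite (eq_bigr (fun x => \sum_(j <- iota 0 M) (src j == x))); last first.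
  by move=> x _; rewrite /degree size_filter count_rev -sumn_count sumnE big_map.
rewrite exchange_big /= -[leqRHS](size_iota 0) -sum1_size leq_sum // => j _.
have -> : \sum_(x <- d) (src j == x) = count_mem (src j) d.
  by rewrite -sumn_count sumnE big_map; apply: eq_bigr => x _; rewrite eq_sym.
by rewrite count_uniq_mem // leq_b1.
Qed.

Lemma explored_size d f lab r k e : explored d f lab r k e -> size (d ++ f) <= n.
Proof.
move=> E; rewrite -(size_iota 0 n); apply: uniq_leq_size; first exact: explored_uniq E.
by move=> x /(explored_lt E); rewrite mem_iota.
Qed.

(** Every label is attained. *)
Lemma explored_count d f lab r k e : explored d f lab r k e -> k <= size (d ++ f).
Proof.
move=> E; rewrite -(size_iota 0 k) -(size_map lab (d ++ f)); apply: uniq_leq_size.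
  exact: iota_uniq.
move=> c; rewrite mem_iota => /(explored_onto E)[x xdf <-].
exact: map_f.
Qed.

End Search.

(** A pointer determines the rest of its list: the key is that of the index
pointed to.  This is what lets the potential depend on the pointer alone. *)
Lemma size_chain_prev key u i :
  size (chain key (key (prev key u i).-1) (prev key u i)) = size (chain key u i).
Proof.
by case De: (prev key u i) => [|e]; rewrite -[in RHS]chain_prev De //= (prev_key De).
Qed.

(** * The graph search program *)

Definition visit (label : expr) : cmd :=
  Seq (put VIS (Reg rVertex) (Cst 1))
 (Seq (put LAB (Reg rVertex) label)
 (Seq (put QUEUE (Reg rTail) (Reg rVertex))
      (incr rTail))).

Definition search_body : cmd :=
  If (Reg rArc)
    (Seq (Assign rVertex (get DST (Sub (Reg rArc) (Cst 1))))
    (Seq (Assign rArc (get ENEXT (Sub (Reg rArc) (Cst 1))))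
         (If (get VIS (Reg rVertex)) Skip (visit (Sub (Reg rNumC) (Cst 1))))))
  (If (Sub (Reg rTail) (Reg rHead))
    (Seq (Assign rArc (get EHEAD (get QUEUE (Reg rHead)))) (incr rHead))
    (Seq (Assign rVertex (Reg rRoot))
    (Seq (incr rRoot)
         (If (get VIS (Reg rVertex)) Skip
            (Seq (visit (Reg rNumC)) (incr rNumC)))))).

Definition search_test : expr :=
  Add (Reg rArc) (Add (Sub (Reg rTail) (Reg rHead))
                       (Sub (Reg rNumV) (Reg rRoot))).

Definition search : cmd :=
  Seq (Assign rNumC (Cst 0))
 (Seq (Assign rRoot (Cst 0))
 (Seq (Assign rHead (Cst 0))
 (Seq (Assign rTail (Cst 0))
 (Seq (Assign rArc (Cst 0))
(While search_test search_body))))).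

Section MachineSearch.
Variables (W T n M : nat) (src dst : nat -> nat) (R : nat -> nat -> Prop).
Hypotheses
  (dst_lt : forall j, j < M -> dst j < n)
  (reverse : forall j, j < M ->
     exists j', [/\ j' < M, src j' = dst j & dst j' = src j])
  (R_refl : forall x, R x x)
  (R_sym : forall x y, R x y -> R y x)
  (R_trans : forall x y z, R x y -> R y z -> R x z)
  (R_edge : forall j, j < M -> R (src j) (dst j))
  (n_le_T : n < T) (M_le_T : M < T) (words : T + T + T < W).

Definition search_frame : astate -> astate -> Prop :=
  frame_on [:: LAB; VIS; QUEUE]
           [:: rNumC; rRoot; rHead; rTail; rArc; rVertex].

Definition search_inv (a b : astate) : Prop :=
  search_frame a b /\
  exists d f,
    [/\ explored n M src dst R d f (aarr b LAB) (areg b rRoot) (areg b rNumC)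
          (areg b rArc),
        areg b rHead = size d /\ areg b rTail = size (d ++ f),
        forall i, i < size (d ++ f) -> aarr b QUEUE i = nth 0 (d ++ f) i
      & forall x, x < n -> (aarr b VIS x != 0) = (x \in d ++ f)].

(** The vertices not taken from the queue, the roots not tried, the arcs
whose source is not taken, and the rest of the current adjacency list.  Taking a
vertex moves its arcs from the third summand to the fourth, so every kind of turn
lowers the sum. *)
Definition search_potential (b : astate) : nat :=
  let e := areg b rArc in
  (n - areg b rHead) + (n - areg b rRoot)
  + (M - \sum_(x <- mkseq (aarr b QUEUE) (areg b rHead)) degree M src x)
  + size (chain src (src e.-1) e).

Lemma queue_done q d f : (forall i, i < size (d ++ f) -> q i = nth 0 (d ++ f) i) ->
  mkseq q (size d) = d.
Proof.
move=> qE; apply: (@eq_from_nth _ 0); rewrite ?size_mkseq // => i id.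
by rewrite nth_mkseq // qE ?nth_cat ?id // size_cat ltn_addr.
Qed.

Lemma search_potentialE b d f : areg b rHead = size d ->
    (forall i, i < size (d ++ f) -> aarr b QUEUE i = nth 0 (d ++ f) i) ->
  search_potential b = (n - size d) + (n - areg b rRoot)
    + (M - \sum_(x <- d) degree M src x)
    + size (chain src (src (areg b rArc).-1) (areg b rArc)).
Proof. by move=> hE qE; rewrite /search_potential hE (queue_done qE). Qed.

Lemma queue_push q s w :
    (forall i, i < size s -> q i = nth 0 s i) ->
  forall i, i < size (rcons s w) ->
    (if i == size s then w else q i) = nth 0 (rcons s w) i.
Proof.
move=> qE i; rewrite size_rcons ltnS nth_rcons leq_eqVlt.
by case: eqVneq => [->|_] /= lt_i; rewrite ?ltnn // lt_i qE.
Qed.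

Lemma wp_search_body a b :
    areg a rNumV = n ->
    (forall j, j < M -> aarr a SRC j = src j) ->
    (forall j, j < M -> aarr a DST j = dst j) ->
    (forall x, x < T -> aarr a EHEAD x = prev src x M) ->
    (forall j, j < M -> aarr a ENEXT j = prev src (src j) j) ->
    search_inv a b ->
  asafe W narrays T b search_test /\ (aval b search_test != 0 ->
  wp W narrays T search_body
    (fun b' => [/\ search_inv a b', search_potential b' < search_potential b
                 & aclock b' <= aclock b + 100]) (atick (cost search_test).+1 b)).
Proof.
move=> an aS aD aH aN.
case: b => [rg ar ck pd os]; set b := AState rg ar ck pd os.
  move=> [[/= Fa Fr Fo] [d [f [/= E [hE tE] qE vE]]]].
  have rn : rg rNumV = n by rewrite Fr.
  have := explored_size E; have [r_le _] := explored_roots E.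
  rewrite -tE => t_le.
  have e_le : rg rArc <= M.
    by case: (posnP (rg rArc)) => [->//|/(explored_edge E)[]].
  have k_le : rg rNumC <= rg rTail.
    by rewrite tE; apply: explored_count E.
  split=> [|nz]; first by rewrite /=; split_safe.
  rewrite /search_body /b /=.
  have [e0|e0] := posnP (rg rArc).
    (* with an empty queue the turn tries the next root *)
    case: f E tE qE vE => [|y f] E tE qE vE.
      have tE' : rg rTail = size d by rewrite tE cats0.
      have r_lt : rg rRoot < n by move: nz; rewrite /= e0 tE' hE rn; lia.
      rewrite e0 in E; have E0 := E.
      have := explored_size E; rewrite cats0 => d_le.
      rewrite e0 tE' hE subnn /= vE // cats0; split_safe.
      case: ifP => rd; split_safe.
      - split; first by split=> //; frame.
        exists d, [::]; rewrite /= addn1; split=> //.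
        by rewrite e0; apply: explored_old_root.
      - by rewrite /search_potential /=; lia.
      - have E' := explored_new_root R_refl E0 r_lt (negbT rd).
        split; first by split=> //; frame.
        exists d, [:: rg rRoot]; rewrite /= !addn1; split=> //.
        + by rewrite e0.
        + by rewrite hE size_cat addn1.
        + by rewrite cats1; apply: queue_push => i; have := qE i; rewrite cats0.
        + move=> x xn; rewrite cats1 mem_rcons inE.
          by rewrite -[d]cats0 -vE //; case: (x =P _).
      - rewrite (@search_potentialE b d [::]) // (@search_potentialE _ d [::]) //=.
          by lia.
        by rewrite cats0 => i lt_i; rewrite ltn_eqF // qE cats0.
    have h_lt : rg rHead < rg rTail by rewrite tE hE size_cat /=; lia.
    have Qy : ar QUEUE (rg rHead) = y.
      by rewrite qE -?tE // hE nth_cat ltnn subnn.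
    have y_lt : y < n by apply: (explored_lt E); rewrite mem_cat mem_head orbT.
    rewrite e0 in E; have E' := explored_pop E.
    (* the queue is not empty: its front vertex is taken *)
    have th : (rg rTail - rg rHead != 0) = true by lia.
    rewrite e0 /= th Qy (Fa EHEAD) // aH; last by lia.
    split_safe.
    - split; first by split=> //; frame.
      exists (rcons d y), f; rewrite /= cat_rcons; split=> //.
      by rewrite size_rcons addn1 hE.
    - rewrite (@search_potentialE _ (rcons d y) f) ?(@search_potentialE b d (y :: f)) //=.
      + have := explored_uniq E'; rewrite cat_uniq => /and3P[/(sum_degree_le M src) + _ _].
        have := explored_size E'; rewrite size_cat size_rcons.
        rewrite e0 size_chain_prev big_rcons /= /degree; lia.
      + by rewrite size_rcons addn1 hE.
      + by rewrite cat_rcons.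
  (* the turn traverses an arc *)
  have [_ ud ue uk] := explored_edge E e0.
  case De: (rg rArc) e0 ue E e_le => [//|e] _ ue E e_le /=; rewrite /= in ue.
  rewrite subn1 /= (Fa DST) // (Fa ENEXT) // aD // aN //.
  have w_lt := dst_lt e_le; rewrite vE //.
  split_safe; case: ifP => wd; [split_safe | ].
  - split; first by split=> //; frame.
    exists d, f; split=> //=; exact: (explored_old reverse E wd).
  - rewrite !(@search_potentialE _ d f) //= De /= size_chain_prev chainS eqxx /=.
    by lia.
  - have E' := explored_new dst_lt R_refl R_sym R_trans R_edge E (negbT wd).
    have := explored_size E'; rewrite -rcons_cat size_rcons -tE => t_lt.
    have qE' i : i < size (d ++ rcons f (dst e)) ->
        (if i == rg rTail then dst e else ar QUEUE i)
        = nth 0 (d ++ rcons f (dst e)) i.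
      by rewrite -rcons_cat tE; apply: queue_push.
    split_safe.
    + split; first by split=> //; frame.
      exists d, (rcons f (dst e)); rewrite /= -rcons_cat; split=> //.
      * by rewrite size_rcons addn1 tE.
      * by rewrite rcons_cat.
      * by move=> x xn; rewrite mem_rcons inE -vE //; case: (x =P _).
    + rewrite (@search_potentialE b d f) // (@search_potentialE _ d (rcons f (dst e))) //=.
        by rewrite De /= size_chain_prev chainS eqxx /=; lia.
Qed.

Lemma wp_search Q a :
    areg a rNumV = n ->
    (forall j, j < M -> aarr a SRC j = src j) ->
    (forall j, j < M -> aarr a DST j = dst j) ->
    (forall x, x < T -> aarr a EHEAD x = prev src x M) ->
    (forall j, j < M -> aarr a ENEXT j = prev src (src j) j) ->
    (forall x, x < T -> aarr a VIS x = 0) ->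
    (forall b, search_frame a b ->
       (forall x, x < n -> aarr b LAB x < areg b rNumC) ->
       (forall c, c < areg b rNumC -> exists2 x, x < n & aarr b LAB x = c) ->
       (forall x y, x < n -> y < n -> aarr b LAB x = aarr b LAB y -> R x y) ->
       (forall j, j < M -> aarr b LAB (dst j) = aarr b LAB (src j)) ->
       areg b rNumC <= n ->
       aclock b <= aclock a + 20 + 100 * (n + n + M) -> Q b) ->
  wp W narrays T search Q a.
Proof.
case: a => rg ar ck pd os; set a := AState rg ar ck pd os.
move=> an aS aD aH aN aV post.
rewrite /search; do 5 (rewrite wp_seq; split=> //; first by rewrite /=; lia).
apply: (@wp_while W _ T (search_inv a) search_potential 100 _ search_body).
- split; first by split=> //; frame.
  exists [::], [::]; split=> [|//|//|x xn]; first by split.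
  by have /= -> // := aV x; lia.
- by move=> b; apply: wp_search_body.
- move=> [rb ab kb pb ob] [Ff [d [f [/= E [hE tE] qE vE]]]] /= z le_c.
  have [/= _ Fr _] := Ff; have rn : rb rNumV = n by rewrite Fr.
  have e0 : rb rArc = 0 by lia.
  have f0 : f = [::].
    by apply: size0nil; move: tE hE; rewrite size_cat; lia.
  have [r_le r_sub] := explored_roots E.
  rewrite f0 e0 ?cats0 in E r_sub.
  have mem_d x : (x < n) = (x \in d).
    apply/idP/idP => [xn|xd]; first by apply: r_sub; rewrite mem_iota; lia.
    by apply: (explored_lt E); rewrite cats0.
  apply: post => //=.
  + by move=> x; rewrite mem_d => xd; apply: (explored_label E); rewrite cats0.
  + move=> c /(explored_onto E)[x]; rewrite cats0 => xd lx.
    by exists x; rewrite ?mem_d.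
  + move=> x y; rewrite !mem_d => xd yd.
    by apply: (explored_conn E); rewrite cats0.
  + move=> j jM; have [|//|//] := explored_done E jM.
    by rewrite -mem_d; have [j' [? ? <-]] := reverse jM; apply: dst_lt.
  + have := explored_count E; have := explored_size E; lia.
  + by move: le_c; rewrite /search_potential /= /mkseq big_nil; lia.
Qed.
End MachineSearch.

(** * Reading the input and measuring components *)

(** A hyperedge of size [z] stored at [p] has its vertices at [p + 1] and
[p + z], which coincide when [z = 1].  Its second arc is stored at a distance of
[|H|], so that reversing an arc does not need any parity test. *)
Definition parse_body : cmd :=
  Seq (put SRC (Reg rIndex) (get IN (Add (Reg rPtr) (Cst 1))))
 (Seq (put DST (Reg rIndex) (get IN (Add (Reg rPtr) (get IN (Reg rPtr)))))
 (Seq (put SRC (Add (Reg rNumE) (Reg rIndex))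
         (get IN (Add (Reg rPtr) (get IN (Reg rPtr)))))
 (Seq (put DST (Add (Reg rNumE) (Reg rIndex)) (get IN (Add (Reg rPtr) (Cst 1))))
      (Assign rPtr (Add (Add (Reg rPtr) (get IN (Reg rPtr))) (Cst 1)))))).

Definition parse : cmd :=
  Seq (Assign rPtr (Cst 2)) (for_loop rIndex rNumE parse_body).

Definition flag_forced_body : cmd :=
  If (Add (Sub (get SRC (Reg rIndex)) (get DST (Reg rIndex)))
          (Sub (get DST (Reg rIndex)) (get SRC (Reg rIndex))))
    Skip (put FLAG (get LAB (get SRC (Reg rIndex))) (Cst 1)).

(** A component is forced when one of its vertices carries a loop, since the
two arcs of a hyperedge are loops exactly when it is a singleton. *)
Definition flag_forced : cmd := for_loop rIndex rNumArcs flag_forced_body.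

Definition measure_unforced_body : cmd :=
  If (get FLAG (get LAB (Reg rIndex))) Skip
    (put SIZE (get LAB (Reg rIndex))
       (Add (get SIZE (get LAB (Reg rIndex))) (Cst 1))).

(** Skipping the vertices of forced components leaves their sort key at 0. *)
Definition measure_unforced : cmd := for_loop rIndex rNumV measure_unforced_body.

Definition collect_body : cmd :=
  If (Reg rPtr)
    (Seq (put LIST (Reg rNumListed) (Sub (Reg rPtr) (Cst 1)))
    (Seq (incr rNumListed)
         (Assign rPtr (get CNEXT (Sub (Reg rPtr) (Cst 1))))))
    (Seq (incr rIndex) (Assign rPtr (get CHEAD (Reg rIndex)))).

(** Starting at size 1 leaves the forced components out.  A single loop
alternates between following a list and moving to the next size. *)
Definition collect : cmd :=
  Seq (Assign rNumListed (Cst 0))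
 (Seq (Assign rPtr (Cst 0))
 (Seq (Assign rIndex (Cst 0))
      (While (Add (Reg rPtr) (Sub (Reg rNumV) (Reg rIndex))) collect_body))).

Section Parsing.
Variables (W T : nat).
Hypothesis words : T + T + T < W.

(** At the turn [i], what is left to read from the pointer on is the encoding
of the hyperedges from [i] on. *)
Lemma wp_parse (blocks : seq (seq nat)) Q a :
    let m := size blocks in
    let src i := if i < m then head 0 (nth [::] blocks i)
                 else last 0 (nth [::] blocks (i - m)) in
    let dst i := if i < m then last 0 (nth [::] blocks i)
                 else head 0 (nth [::] blocks (i - m)) in
    areg a rNumE = m -> 2 + (m + m + m) <= T ->
    (forall B, B \in blocks -> 0 < size B <= 2) ->
    (forall x, 2 + x < T -> aarr a IN (2 + x)
       = nth 0 (flatten [seq size B :: B | B <- blocks]) x) ->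
    (forall b, frame_on [:: SRC; DST] [:: rIndex; rPtr] a b ->
       (forall j, j < m + m -> aarr b SRC j = src j) ->
       (forall j, j < m + m -> aarr b DST j = dst j) ->
       aclock b <= aclock a + 10 + 100 * m -> Q b) ->
  wp W narrays T parse Q a.
Proof.
case: a => rg ar ck pd os; set a := AState rg ar ck pd os.
move=> m src dst am mT rk input post; rewrite /parse wp_seq; split=> //.
  by rewrite /=; lia.
pose F i := flatten [seq size B :: B | B <- drop i blocks].
pose I i b := [/\ frame_on [:: SRC; DST] [:: rIndex; rPtr] a b,
   forall i', i' < i ->
     [/\ aarr b SRC i' = src i', aarr b SRC (m + i') = src (m + i'),
         aarr b DST i' = dst i' & aarr b DST (m + i') = dst (m + i')],
   areg b rPtr <= 2 + (i + i + i) /\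
   (forall x, areg b rPtr + x < T ->
      aarr b IN (areg b rPtr + x) = nth 0 (F i) x)
   & aclock b <= aclock a + 4 + 100 * i].
rewrite /= in am input post.
apply: (@wp_for _ _ _ I _ _ parse_body) => //.
- by rewrite /= am; lia.
- split=> //=; last by lia.
  + by split=> //; frame.
  + by split=> // x xT; rewrite input // /F drop0.
- move=> i [rb ab kb pb ob] im [Fb done_i [p_le pE] le_c] bi bm.
  rewrite /= am in im done_i p_le pE le_c bi bm.
  have [/= Fa Fr Fo] := Fb.
  set B := nth [::] blocks i.
  have szB : 0 < size B <= 2 by apply: rk; apply: mem_nth.
  have FE : F i = size B :: B ++ F i.+1 by rewrite /F (drop_nth [::] im).
  have in0 : ab IN (rb rPtr) = size B.
    by rewrite -[rb rPtr]addn0 pE ?FE //; lia.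
  have in1 : ab IN (rb rPtr + 1) = head 0 B.
    by rewrite pE ?FE /=; [case: (B) szB | lia].
  have in2 : ab IN (rb rPtr + size B) = last 0 B.
    rewrite pE ?FE; last by lia.
    by case: (B) szB => // x s _; rewrite /= -cat_cons nth_cat /= ltnSn (last_nth 0).
  rewrite /parse_body /= in0 in1 in2 bi bm.
  have srcE : src i = head 0 B by rewrite /src im.
  have dstE : dst i = last 0 B by rewrite /dst im.
  have srcE' : src (m + i) = last 0 B.
    by rewrite /src ltnNge leq_addr addKn.
  have dstE' : dst (m + i) = head 0 B.
    by rewrite /dst ltnNge leq_addr addKn.
  split_safe.
  split=> //=; [split=> //| |split=> /=|by lia].
  + move=> j; rewrite !inE negb_or => /andP[/negPf h1 /negPf h2].
    by rewrite /= h1 h2 Fa // !inE h1 h2.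
  + by frame.
  + move=> i'; rewrite ltnS leq_eqVlt => /orP[/eqP->|lt_i].
      have e1 : (i == m + i) = false by lia.
      by rewrite !eqxx srcE srcE' dstE dstE' e1.
    have [h1 h2 h3 h4] := done_i _ lt_i.
    have e1 : (i' == m + i) = false by lia.
    have e2 : (m + i' == i) = false by lia.
    by rewrite !eqn_add2l !(ltn_eqF lt_i) e1 e2.
  + by lia.
  + move=> x xT; have -> : rb 8 + size B + 1 + x = rb 8 + (size B + x).+1 by lia.
    rewrite pE; last by lia.
    by rewrite FE /= nth_cat ltnNge leq_addr addKn.
- move=> [rb ab kb pb ob] [Fb done_m _ le_c].
  rewrite /= am in done_m le_c.
  apply: post => //=; last by lia.
  + move=> j jm; case: (ltnP j m) => [/done_m[]//|mj].
    by have [|_ + _ _] := done_m (j - m); [lia | rewrite subnKC].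
  + move=> j jm; case: (ltnP j m) => [/done_m[]//|mj].
    by have [|_ _ _] := done_m (j - m); [lia | rewrite subnKC].
Qed.
End Parsing.

(** * Sorting components by size *)

(** Concatenated buckets are sorted by key, which is the only order that the
enumeration needs. *)
Definition buckets (key : nat -> nat) (k a n : nat) : seq nat :=
  flatten [seq chain key z k | z <- iota a n].

Lemma mem_buckets key k a n c :
  (c \in buckets key k a n) = (c < k) && (a <= key c < a + n).
Proof.
apply/flatten_mapP/andP => [[z]|[ck az]].
  by rewrite mem_iota mem_chain => az /andP[-> /eqP->].
by exists (key c); rewrite ?mem_iota // mem_chain ck eqxx.
Qed.

Lemma buckets_uniq key k a n : uniq (buckets key k a n).
Proof.
elim: n a => // n IH a; rewrite /buckets /= cat_uniq chain_uniq IH andbT /=.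
apply/hasPn => c; rewrite -/(buckets _ _ _ _) mem_buckets mem_chain.
by case: eqP => [->|_]; rewrite ?andbF // ltnn andbF.
Qed.

Lemma buckets_sorted key k a n : sorted leq (map key (buckets key k a n)).
Proof.
rewrite (sorted_pairwise leq_trans).
elim: n a => // n IH a; rewrite /buckets /= map_cat pairwise_cat IH andbT.
apply/andP; split.
  apply/allrelP => x y /mapP[c + ->] /mapP[d + ->].
  by rewrite mem_chain -/(buckets _ _ _ _) mem_buckets => /andP[_ /eqP->]; lia.
have : all (fun c => key c == a) (chain key a k).
  by apply/allP => c; rewrite mem_chain => /andP[].
elim: (chain key a k) => //= c s IHs /andP[/eqP kc /[dup] /IHs -> s_a].
by rewrite andbT all_map; apply: sub_all s_a => d /= /eqP->; rewrite kc.
Qed.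

Lemma size_buckets key k a n : size (buckets key k a n) <= k.
Proof.
rewrite -[leqRHS](size_iota 0); apply: uniq_leq_size; first exact: buckets_uniq.
by move=> c; rewrite mem_buckets mem_iota => /andP[].
Qed.

Section Sorting.
Variables (W T n : nat).
Hypotheses (n_le_T : n < T) (words : T + T + T < W).

Definition loop_at src dst (lab : nat -> nat) (c j : nat) : bool :=
  (src j == dst j :> nat) && (lab (src j) == c).

Lemma wp_flag_forced (src dst lab : nat -> nat) Q a :
    let M := areg a rNumArcs in
    M < T ->
    (forall j, j < M -> src j < n) -> (forall j, j < M -> dst j < n) ->
    (forall x, x < n -> lab x < T) ->
    (forall j, j < M -> aarr a SRC j = src j) ->
    (forall j, j < M -> aarr a DST j = dst j) ->
    (forall x, x < n -> aarr a LAB x = lab x) ->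
    (forall c, c < T -> aarr a FLAG c = 0) ->
    (forall b, frame_on [:: FLAG] [:: rIndex] a b ->
       (forall c, c < T ->
          (aarr b FLAG c != 0) = has (loop_at src dst lab c) (iota 0 M)) ->
       aclock b <= aclock a + 10 + 100 * M -> Q b) ->
  wp W narrays T flag_forced Q a.
Proof.
case: a => rg ar ck pd os; set a := AState rg ar ck pd os.
move=> M MT src_lt dst_lt lab_lt aS aD aL aF post.
pose I i b := [/\ frame_on [:: FLAG] [:: rIndex] a b,
   forall c, c < T ->
     (aarr b FLAG c != 0) = has (loop_at src dst lab c) (iota 0 i)
   & aclock b <= aclock a + 2 + 100 * i].
rewrite /= in M MT src_lt dst_lt aS aD aL aF post.
apply: (@wp_for _ _ _ I _ _ flag_forced_body) => //.
- by rewrite /= -/M; lia.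
- split=> //=; [by split=> //; frame | by move=> c cT; rewrite aF | by lia].
- move=> i [rb ab kb pb ob] iM [Fb fE le_c] bi bM.
  rewrite /= -/M in iM fE le_c bi bM.
  have [/= Fa Fr Fo] := Fb.
  have si := src_lt _ iM; have di := dst_lt _ iM; have li := lab_lt _ si.
  rewrite /flag_forced_body /= bi !(Fa SRC) // !(Fa DST) // !(Fa LAB) //.
  rewrite aS // aD // aL //.
  have hasE c : has (loop_at src dst lab c) (iota 0 i.+1) =
      has (loop_at src dst lab c) (iota 0 i) || loop_at src dst lab c i.
    by rewrite -addn1 iotaD has_cat /= orbF.
  split_safe.
  (* the two truncated differences add up to the distance *)
  have eqE : (src i - dst i + (dst i - src i) == 0) = (src i == dst i) by lia.
  rewrite eqE; case: ifP => E; split_safe; split=> //; try by rewrite /=; lia.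
  + by split=> //; frame.
  + by move=> c cT; rewrite hasE /= fE // /loop_at (negPf E) orbF.
  + split=> //; last by frame.
    by move=> j jF; rewrite /= -Fa //; move: jF; rewrite inE => /negPf->.
  + move=> c cT; rewrite hasE /= /loop_at; move: E; case: eqP => //= _ _.
    by rewrite [c == _]eq_sym; case: (_ =P c) => _; rewrite ?orbT ?orbF // fE.
- move=> [rb ab kb pb ob] [Fb fE le_c]; rewrite /= -/M in fE le_c.
  by apply: post => //=; lia.
Qed.

Lemma wp_measure_unforced (lab : nat -> nat) Q a :
    areg a rNumV = n ->
    (forall x, x < n -> lab x < T) ->
    (forall x, x < n -> aarr a LAB x = lab x) ->
    (forall c, c < T -> aarr a SIZE c = 0) ->
    (forall b, frame_on [:: SIZE] [:: rIndex] a b ->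
       (forall c, c < T -> aarr b SIZE c =
          if aarr a FLAG c != 0 then 0 else size (chain lab c n)) ->
       aclock b <= aclock a + 10 + 100 * n -> Q b) ->
  wp W narrays T measure_unforced Q a.
Proof.
case: a => rg ar ck pd os; set a := AState rg ar ck pd os.
move=> an lab_lt aL aZ post.
pose sz i c := if ar FLAG c != 0 then 0 else size (chain lab c i).
pose I i b := [/\ frame_on [:: SIZE] [:: rIndex] a b,
   forall c, c < T -> aarr b SIZE c = sz i c
   & aclock b <= aclock a + 2 + 100 * i].
rewrite /= in an lab_lt aL aZ post.
apply: (@wp_for _ _ _ I _ _ measure_unforced_body) => //.
- by rewrite /= an; lia.
- split=> //=; [by split=> //; frame | | by lia].
  by move=> c cT; rewrite aZ // /sz; case: ifP.
- move=> i [rb ab kb pb ob] iM [Fb fE le_c] bi bM.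
  rewrite /= an in iM fE le_c bi bM.
  have [/= Fa Fr Fo] := Fb.
  have li := lab_lt _ iM.
  have sz_le : sz i (lab i) <= i.
    rewrite /sz; case: ifP => // _; rewrite size_filter -[leqRHS](size_iota 0).
    by rewrite count_rev count_size.
  rewrite /measure_unforced_body /= bi !(Fa FLAG) // !(Fa LAB) // aL //.
  split_safe.
  case: ifP => E.
    split_safe; split=> //=; [by split=> //; frame | | by lia].
    move=> c cT; rewrite fE // /sz chainS.
    by case: (lab i =P c) => // <-; rewrite E.
  rewrite fE //.
  split_safe; split=> //=; [split=> //; last by frame | | by lia].
  + by move=> j jF; rewrite /= -Fa //; move: jF; rewrite inE => /negPf->.
  + move=> c cT; rewrite fE // /sz chainS [c == _]eq_sym.
    by case: (lab i =P c) => // <-; rewrite E addn1.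
- move=> [rb ab kb pb ob] [Fb fE le_c]; rewrite /= an in fE le_c.
  by apply: post => //=; lia.
Qed.

Lemma mkseq_push (f : nat -> nat) i v :
  mkseq (fun x => if x == i then v else f x) i.+1 = rcons (mkseq f i) v.
Proof.
rewrite mkseqS eqxx; congr rcons; apply/eq_in_map => x.
by rewrite mem_iota => /andP[_ xi]; rewrite ltn_eqF.
Qed.

(** The entries already listed, the rest of the current list and the buckets
of larger size always concatenate to the same sequence. *)
Lemma wp_collect (sz : nat -> nat) k Q a :
    let cs := buckets sz k 1 n in
    areg a rNumV = n -> k < T ->
    (forall z, z < T -> aarr a CHEAD z = prev sz z k) ->
    (forall c, c < k -> aarr a CNEXT c = prev sz (sz c) c) ->
    (forall b, frame_on [:: LIST] [:: rIndex; rPtr; rNumListed] a b ->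
       areg b rNumListed = size cs ->
       (forall i, i < size cs -> aarr b LIST i = nth 0 cs i) ->
       aclock b <= aclock a + 20 + 100 * (k + n) -> Q b) ->
  wp W narrays T collect Q a.
Proof.
case: a => rg ar ck pd os; set a := AState rg ar ck pd os.
move=> cs an kT aH aN post.
have cs_le : size cs <= k := size_buckets sz k 1 n.
pose I b := [/\ frame_on [:: LIST] [:: rIndex; rPtr; rNumListed] a b,
   areg b rIndex <= n, areg b rPtr <= k,
   0 < areg b rPtr -> sz (areg b rPtr).-1 = areg b rIndex
   & cs = mkseq (aarr b LIST) (areg b rNumListed)
          ++ chain sz (areg b rIndex) (areg b rPtr)
          ++ buckets sz k (areg b rIndex).+1 (n - areg b rIndex)].
rewrite /= in an aH aN post.
rewrite /collect; do 3 (rewrite wp_seq; split=> //; first by rewrite /=; lia).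
apply: (@wp_while W _ T I
  (fun b => (size cs - areg b rNumListed) + (n - areg b rIndex)) 60 _ collect_body).
- split=> //=; first by split=> //; frame.
  by rewrite subn0.
- move=> [rb ab kb pb ob] [[/= Fa Fr Fo] z_le p_le p_key csE].
  have rn : rb rNumV = n by rewrite Fr.
  split=> [|nz]; first by rewrite /=; split_safe.
  rewrite /collect_body /=.
  have := congr1 size csE; rewrite !size_cat size_mkseq => sE.
  case Dp: (rb rPtr) p_key csE sE p_le nz => [|p] /= p_key csE sE p_le nz.
    have z_lt : rb rIndex < n by lia.
    have zT : rb rIndex + 1 < T by lia.
    rewrite (Fa CHEAD) // aH //; split_safe.
    split=> //=; [by split=> //; frame | by lia | by apply: prev_le | | ].
      by case Dq: (prev _ _ _) => [//|q] _; apply: prev_key Dq.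
    rewrite csE addn1 chain_prev; congr cat.
    by rewrite -(subnSK z_lt) /buckets.
  have := p_key isT => zE.
  rewrite subn1 /= (Fa CNEXT) // aN //.
  have lt_c : rb rNumListed < size cs by move: sE; rewrite chainS zE eqxx /=; lia.
  split_safe.
  split=> //=; [|by have := prev_le sz (sz p) p; lia| |].
  + split=> //; last by frame.
    by move=> j jF; rewrite /= -Fa //; move: jF; rewrite inE => /negPf->.
  + by case Dq: (prev _ _ _) => [//|q] _; rewrite -zE; apply: prev_key Dq.
  + by rewrite csE addn1 mkseq_push -cats1 -catA chainS zE eqxx /= -zE chain_prev.
- move=> [rb ab kb pb ob] [Fb z_le p_le p_key csE] /= z le_c.
  rewrite /= in z_le p_le p_key csE.
  have [/= _ Fr _] := Fb.
  have rn : rb rNumV = n by rewrite Fr.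
  have p0 : rb rPtr = 0 by lia.
  have zn : rb rIndex = n by lia.
  have csE' : cs = mkseq (ab LIST) (rb rNumListed).
    by rewrite csE p0 zn subnn !cats0.
  apply: post => //=.
  + by rewrite csE' size_mkseq.
  + by move=> i; rewrite csE' size_mkseq => ic; rewrite nth_mkseq.
  + by move: le_c; rewrite /=; lia.
Qed.
End Sorting.

(** * Output loops *)

Definition emit_component : cmd :=
  Seq (Assign rPtr (get VHEAD (Reg rComp)))
    (While (Reg rPtr)
       (Seq (Emit (Sub (Reg rPtr) (Cst 1)))
            (Assign rPtr (get VNEXT (Sub (Reg rPtr) (Cst 1)))))).

(** With [d] the distance between two labels, [1 - (1 - d)] is 0 when they
agree and 1 otherwise. *)
Definition emit_bit : cmd :=
  Emit (Sub (Cst 1) (Sub (Cst 1)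
    (Add (Sub (get LAB (Reg rVertex)) (Reg rComp))
         (Sub (Reg rComp) (get LAB (Reg rVertex)))))).

Definition emit_vector : cmd := for_loop rVertex rNumV emit_bit.

Definition emit_all (emit_one : cmd) : cmd :=
  for_loop rIndex rNumListed
    (Seq (Assign rComp (get LIST (Reg rIndex))) (Seq emit_one Flush)).

(** The components are listed by size in any case, so the requested order
makes no difference. *)
Definition enumerate (m : mode) (by_size : bool) : cmd :=
  emit_all (if m is SparseComplement then emit_component else emit_vector).

Lemma all2_rcons (S U : Type) (r : S -> U -> bool) s t x y :
  all2 r (rcons s x) (rcons t y) = all2 r s t && r x y.
Proof.
elim: s t => [|a s IH] [|b t] /=; rewrite ?andbT ?IH ?andbA //.
- by case: t => [|? ?]; rewrite /= andbF.
- by case: s {IH} => [|? ?]; rewrite /= andbF.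
Qed.

Section Enumerators.
Variables (W T n : nat).
Hypotheses (n_le_T : n < T) (words : T + T + T < W).

Definition same_except (registers : seq nat) (a b : astate) : Prop :=
  (forall j, aarr b j = aarr a j) /\
  (forall x, x \notin registers -> areg b x = areg a x).

(** The contract between the outer loop and the output of one component.  The
lower bound on the time is what makes the delay of the right order from below. *)
Definition emits (a : astate) (cs : seq nat) (emit_one : cmd)
    (word : nat -> seq nat) (f : nat -> nat) (K : nat) : Prop :=
  forall b Q, same_except [:: rIndex; rPtr; rVertex; rComp] a b ->
    areg b rComp \in cs -> apending b = [::] ->
    (forall b', same_except [:: rPtr; rVertex] b b' ->
       apending b' = word (areg b rComp) -> aouts b' = aouts b ->
       aclock b + f (areg b rComp) <= aclock b'
         <= aclock b + K * f (areg b rComp) ->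
       Q b') ->
    wp W narrays T emit_one Q b.

(** A turn of the outer loop spends a bounded number of steps outside of
[emit_one], which the additional 20 accounts for as [f] is positive.  The delay
of an output runs from the previous one, whose time is the last entry of the
output list, so the invariant bounds the steps made since. *)
Lemma wp_emit_all a cs emit_one word f K Q :
    emits a cs emit_one word f K -> {in cs, forall c, 0 < f c} ->
    areg a rNumListed = size cs -> size cs < T ->
    (forall i, i < size cs -> aarr a LIST i = nth 0 cs i) ->
    apending a = [::] -> aouts a = [::] ->
    (forall b, apending b = [::] ->
       [seq o.2 | o <- aouts b] = [seq word c | c <- cs] ->
       all2 (fun c d => theta (K + 20) (f c) d) cs
         (delays (aclock a) [seq o.1 | o <- aouts b]) ->
       aclock b <= aclock a + 6 + (K + 20) * \sum_(c <- cs) f c -> Q b) ->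
  wp W narrays T (emit_all emit_one) Q a.
Proof.
case: a => rg ar ck pd os; set a := AState rg ar ck pd os.
move=> em f_pos aC cT aL aP aO post; set C := K + 20.
pose I i b := [/\ same_except [:: rIndex; rPtr; rVertex; rComp] a b,
    apending b = [::],
    [seq o.2 | o <- aouts b] = [seq word c | c <- take i cs]
  & let ts := [seq o.1 | o <- aouts b] in
    [/\ all2 (fun c d => theta C (f c) d) (take i cs) (delays ck ts),
        last ck ts <= aclock b <= last ck ts + 6
      & aclock b <= ck + 2 + C * \sum_(c <- take i cs) f c]].
rewrite /= in aC aL aP aO post.
apply: (@wp_for _ _ _ I) => //.
- by rewrite /= aC; lia.
- split=> //=; [by split=> //; frame | by rewrite aO take0 |].
  by rewrite aO take0 big_nil /=; split=> //; lia.
- move=> i [rb ab kb pb ob] i_lt [Sb pE oE [dE /andP[kb1 kb2] kb3]] bi bC.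
  rewrite /= aC in i_lt Sb pE oE dE kb1 kb2 kb3 bi bC.
  have [/= Sa Sr] := Sb.
  rewrite /=; split_safe.
  have cE : ab LIST (rb rIndex) = nth 0 cs i by rewrite Sa bi aL.
  have c_in : nth 0 cs i \in cs by apply: mem_nth.
  apply: em; rewrite /= ?cE //.
    split=> //=; frame.
  move=> [rb' ab' kb' pb' ob'] [/= Sa' Sr'] pE' oE' /andP[kb1' kb2'].
  have f0 := f_pos _ c_in; set c := nth 0 cs i in cE c_in kb1' kb2' f0 pE' *.
  have bi' : rb' rIndex = i by rewrite Sr'.
  have KC : C * f c = K * f c + 20 * f c by rewrite mulnDl.
  rewrite /= bi' addn1; split_safe; last by rewrite Sr' //= bC.
  + split=> //=.
    * split=> /= [j|x xN]; first by rewrite Sa' Sa.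
      rewrite -Sr //; move: (xN); rewrite !inE !negb_or => /and4P[h1 h2 h3 h4].
      by rewrite (negPf h1) Sr' ?inE ?negb_or ?h2 ?h3 //= (negPf h4).
    * by rewrite map_rcons (take_nth 0) // map_rcons oE' oE pE'.
    * rewrite map_rcons /= oE' last_rcons (take_nth 0) // -/c.
      rewrite /delays -(cats1 [seq o.1 | o <- ob]) pairmap_cat cats1.
      rewrite all2_rcons -/(delays _ _) dE /=.
      rewrite -cats1 big_cat big_seq1 /= mulnDr /theta.
      by split; [apply/andP; split | |]; nia.
- move=> [rb ab kb pb ob] [Sb pE oE [dE _ kb3]].
  rewrite /= aC take_size in oE dE kb3.
  by apply: post => //=; lia.
Qed.

Lemma emits_component a lab k cs :
    (forall c, c \in cs -> c < k) -> k < T ->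
    (forall c, c < k -> aarr a VHEAD c = prev lab c n) ->
    (forall x, x < n -> aarr a VNEXT x = prev lab (lab x) x) ->
  emits a cs emit_component (fun c => chain lab c n)
    (fun c => size (chain lab c n) + 1) 60.
Proof.
case: a => rg ar ck pd os; set a := AState rg ar ck pd os.
move=> ck_lt kT aH aN [rb ab kb pb ob] Q Sb0 /ck_lt c_lt pE post; simpl in c_lt, pE, post.
have [Sa Sr] := Sb0; simpl in Sa, Sr.
simpl in aH, aN.
set c := rb rComp in c_lt post.
pose I b' := [/\ same_except [:: rPtr; rVertex] (AState rb ab kb pb ob) b',
    aouts b' = ob, areg b' rPtr <= n,
    0 < areg b' rPtr -> lab (areg b' rPtr).-1 = c
  & apending b' ++ chain lab c (areg b' rPtr) = chain lab c n /\
    kb + 1 + size (apending b') <= aclock b'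
      <= kb + 20 + 20 * size (apending b')].
rewrite /emit_component wp_seq; split=> //; first by rewrite /=; split_safe.
have hE : ab VHEAD c = prev lab c n by rewrite Sa aH.
exists I, (fun b' => areg b' rPtr); split.
  split=> //=; rewrite -/c hE; last split.
  - by split=> //; frame.
  - exact: prev_le.
  - by case Dq: (prev _ _ _) => [//|q] _; apply: prev_key Dq.
  - by rewrite pE chain_prev.
  - by rewrite pE /=; lia.
move=> [r m t p o] [/= Sb oE p_le p_key [pend /andP[t1 t2]]].
split=> //; case: eqP => [p0|] /=.
  apply: post => //=; first by rewrite -pend p0 cats0.
  by rewrite -/c -pend p0 cats0; lia.
have [/= Ma Mr] := Sb.
case Dp: (r rPtr) p_key pend p_le => [|q] //= p_key pend p_le _.
have qE := p_key isT.
rewrite subn1 /= Ma Sa aN //; split_safe; last first.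
  by have := prev_le lab (lab q) q; lia.
split=> //=.
- by split=> //; frame.
- by have := prev_le lab (lab q) q; lia.
- by case Dq: (prev _ _ _) => [//|x] _; rewrite -qE; apply: prev_key Dq.
- rewrite -pend chainS qE eqxx size_rcons -cats1 -catA /= -qE chain_prev.
  by split=> //; lia.
Qed.

Lemma emits_vector a lab cs :
    areg a rNumV = n -> (forall x, x < n -> aarr a LAB x = lab x) ->
    (forall x, x < n -> lab x < T) -> (forall c, c \in cs -> c < n) ->
  emits a cs emit_vector
    (fun c => [seq nat_of_bool (lab x != c) | x <- iota 0 n]) (fun=> n) 60.
Proof.
case: a => rg ar ck pd os; set a := AState rg ar ck pd os.
move=> an aL lab_lt c_lt [rb ab kb pb ob] Q Sb0 /c_lt cT pE post; simpl in cT, pE, post.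
have [Sa Sr] := Sb0; simpl in Sa, Sr.
simpl in an, aL.
have rn : rb rNumV = n by rewrite Sr.
set c := rb rComp in cT post.
pose I i b' := [/\ same_except [:: rPtr; rVertex] (AState rb ab kb pb ob) b',
    aouts b' = ob,
    apending b' = [seq nat_of_bool (lab x != c) | x <- iota 0 i]
  & kb + i <= aclock b' <= kb + 2 + 50 * i].
apply: (@wp_for _ _ _ I _ _ emit_bit) => //.
- by rewrite /= rn; lia.
- by split=> //=; [split=> //; frame | lia].
- move=> i [r m t p o] i_lt [Sb oE pE' /andP[t1 t2]] bi bN.
  rewrite /= rn in i_lt Sb oE pE' t1 t2 bi bN.
  have [/= Ma Mr] := Sb; have cE : r rComp = c by rewrite Mr.
  have li := lab_lt _ i_lt.
  rewrite /emit_bit /= bi cE !Ma !Sa !aL //.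
  split_safe.
  split=> //; last by rewrite /=; lia.
  + by split=> //; frame.
  + have -> : iota 0 i.+1 = rcons (iota 0 i) i by rewrite -addn1 iotaD cats1.
    rewrite map_rcons -pE' /=; congr rcons.
    by case: eqP => /=; lia.
- move=> [r m t p o] [Sb oE pE' t12].
  rewrite /= rn in Sb oE pE' t12.
  by apply: post => //=; lia.
Qed.
End Enumerators.

(** * Preprocessing as a whole *)

Definition preprocess : cmd :=
  Seq parse
 (Seq (bucketize SRC EHEAD ENEXT rNumArcs)
 (Seq search
 (Seq flag_forced
 (Seq (bucketize LAB VHEAD VNEXT rNumV)
 (Seq measure_unforced
 (Seq (bucketize SIZE CHEAD CNEXT rNumC)
 (Seq collect
 (Seq (Assign rLAB (Reg (array_reg LAB)))
      (Assign rFLAG (Reg (array_reg FLAG))))))))))).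

(** Giving the key 0 to forced components sends them to the bucket that is not
listed. *)
Definition unforced_size (n M : nat) (src dst lab : nat -> nat) (c : nat) : nat :=
  if has (loop_at src dst lab c) (iota 0 M) then 0 else size (chain lab c n).

(** What the preprocessing leaves in memory, for a labelling [lab] with [k]
labels whose classes are exactly the classes of the relation generated by the
arcs: labels agree along arcs, and vertices with the same label are related by
[R], which may be any equivalence containing the arcs. *)
Record prepared (n M : nat) (src dst : nat -> nat) (R : nat -> nat -> Prop)
    (lab : nat -> nat) (k : nat) (b : astate) : Prop := Prepared {
  prepared_regs : [/\ areg b rNumC = k, areg b rNumV = n,
    areg b rLAB = areg b (array_reg LAB)
    & areg b rFLAG = areg b (array_reg FLAG)];
  prepared_k : k <= n;
  prepared_lt : forall x, x < n -> lab x < k;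
  prepared_onto : forall c, c < k -> exists2 x, x < n & lab x = c;
  prepared_conn : forall x y, x < n -> y < n -> lab x = lab y -> R x y;
  prepared_edge : forall j, j < M -> lab (dst j) = lab (src j);
  prepared_lab : forall x, x < n -> aarr b LAB x = lab x;
  prepared_flag : forall c, c < k ->
    (aarr b FLAG c != 0) = has (loop_at src dst lab c) (iota 0 M);
  prepared_head : forall c, c <= n -> aarr b VHEAD c = prev lab c n;
  prepared_next : forall x, x < n -> aarr b VNEXT x = prev lab (lab x) x;
  prepared_list :
    let cs := buckets (unforced_size n M src dst lab) k 1 n in
    areg b rNumListed = size cs /\
    forall i, i < size cs -> aarr b LIST i = nth 0 cs i }.

Section Preprocess.
Variables (n : nat) (blocks : seq (seq nat)) (R : nat -> nat -> Prop).
Let m := size blocks.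
Let src i := if i < m then head 0 (nth [::] blocks i)
             else last 0 (nth [::] blocks (i - m)).
Let dst i := if i < m then last 0 (nth [::] blocks i)
             else head 0 (nth [::] blocks (i - m)).
Hypotheses
  (block_size : forall B, B \in blocks -> 0 < size B <= 2)
  (block_lt : forall B x, B \in blocks -> x \in B -> x < n)
  (R_refl : forall x, R x x)
  (R_sym : forall x y, R x y -> R y x)
  (R_trans : forall x y z, R x y -> R y z -> R x z)
  (R_block : forall B, B \in blocks -> R (head 0 B) (last 0 B)).

Let nth_block j : j < m + m ->
  exists B, [/\ B \in blocks, head 0 B < n, last 0 B < n &
    if j < m then src j = head 0 B /\ dst j = last 0 B
    else src j = last 0 B /\ dst j = head 0 B].
Proof.
move=> jM; exists (nth [::] blocks (if j < m then j else j - m)).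
set B := nth _ _ _.
have BH : B \in blocks by apply: mem_nth; rewrite -/m; case: ifP; lia.
split=> //.
- by apply: (block_lt BH); case: (B) (block_size BH) => // x s _; apply: mem_head.
- by apply: (block_lt BH); case: (B) (block_size BH) => // x s _; apply: mem_last.
- by rewrite /src /dst /B; case: (j < m).
Qed.

Lemma arc_src_lt j : j < m + m -> src j < n.
Proof. by case/nth_block=> B [_ h l]; case: ifP => _ [-> _]. Qed.

Lemma arc_dst_lt j : j < m + m -> dst j < n.
Proof. by case/nth_block=> B [_ h l]; case: ifP => _ [_ ->]. Qed.

Lemma arc_reverse j : j < m + m ->
  exists j', [/\ j' < m + m, src j' = dst j & dst j' = src j].
Proof.
move=> jM; exists (if j < m then m + j else j - m).
rewrite /src /dst; case: (ltnP j m) => jm.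
  have e : (m + j < m) = false by lia.
  by rewrite e addKn; split=> //; lia.
have e : (j - m < m) = true by lia.
by rewrite e; split=> //; lia.
Qed.

Lemma arc_related j : j < m + m -> R (src j) (dst j).
Proof.
case/nth_block=> B [/R_block RB _ _]; case: ifP => _ [-> ->] //.
exact: R_sym.
Qed.

Variables W T : nat.
Hypotheses (T_ge : n + 3 * m + 2 <= T) (words : T + T + T < W).

Lemma wp_preprocess Q a :
    [/\ areg a rNumV = n, areg a rNumE = m & areg a rNumArcs = m + m] ->
    (forall j i, 0 < j -> i < T -> aarr a j i = 0) ->
    (forall x, 2 + x < T -> aarr a IN (2 + x)
       = nth 0 (flatten [seq size B :: B | B <- blocks]) x) ->
    (forall b lab k, prepared n (m + m) src dst R lab k b ->
       apending b = apending a -> aouts b = aouts a ->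
       aclock b <= aclock a + 100 + 600 * (n + m) -> Q b) ->
  wp W narrays T preprocess Q a.
Proof.
move=> [aN aE aM] zero input post.
rewrite /preprocess wp_seq; apply: (@wp_parse W T words blocks) => //; first lia.
move=> b1 [Fa1 Fr1 [Fp1 Fo1]] S1 D1 c1.
rewrite wp_seq; apply: (@wp_bucketize _ _ _ src) => //; rewrite ?Fr1 // ?aM.
- lia.
- lia.
- exact: S1.
- by move=> j jM; have := arc_src_lt jM; lia.
- by move=> x xT; rewrite Fa1 // zero.
move=> b2 [Fa2 Fr2 [Fp2 Fo2]] H2 N2 c2.
rewrite wp_seq.
apply: (wp_search arc_dst_lt arc_reverse R_refl R_sym R_trans arc_related) => //; try lia.
- by rewrite Fr2 // Fr1.
- by move=> j jM; rewrite Fa2 // S1.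
- by move=> j jM; rewrite Fa2 // D1.
- by move=> x xT; rewrite Fa2 // Fa1 // zero.
move=> b3 [Fa3 Fr3 [Fp3 Fo3]] lt3 onto3 conn3 edge3 k_le c3.
set lab := aarr b3 LAB in lt3 onto3 conn3 edge3.
set k := areg b3 rNumC in lt3 onto3 k_le.
have n_lt_T : n < T by lia.
rewrite wp_seq; apply: (@wp_flag_forced W T n n_lt_T words src dst lab);
  rewrite ?Fr3 // ?Fr2 // ?Fr1 // ?aM.
- lia.
- exact: arc_src_lt.
- exact: arc_dst_lt.
- by move=> x /lt3; lia.
- by move=> j jM; rewrite Fa3 // Fa2 // S1.
- by move=> j jM; rewrite Fa3 // Fa2 // D1.
- by move=> c cT; rewrite Fa3 // Fa2 // Fa1 // zero.
move=> b4 [Fa4 Fr4 [Fp4 Fo4]] flag4 c4.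
rewrite wp_seq; apply: (@wp_bucketize _ _ _ lab) => //;
  rewrite ?Fr4 // ?Fr3 // ?Fr2 // ?Fr1 // ?aN.
- lia.
- lia.
- by move=> x xn; rewrite Fa4.
- by move=> x /lt3; lia.
- by move=> c cT; rewrite Fa4 // Fa3 // Fa2 // Fa1 // zero.
move=> b5 [Fa5 Fr5 [Fp5 Fo5]] H5 N5 c5.
rewrite wp_seq; apply: (@wp_measure_unforced W T n n_lt_T words lab).
- by rewrite Fr5 // Fr4 // Fr3 // Fr2 // Fr1.
- by move=> x /lt3; lia.
- by move=> x xn; rewrite Fa5 // Fa4.
- by move=> c cT; rewrite Fa5 // Fa4 // Fa3 // Fa2 // Fa1 // zero.
move=> b6 [Fa6 Fr6 [Fp6 Fo6]] size6 c6.
have k6 : areg b6 rNumC = k by rewrite Fr6 // Fr5 // Fr4.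
set sz := unforced_size n (m + m) src dst lab.
have szE c : c < T -> aarr b6 SIZE c = sz c.
  by move=> cT; rewrite size6 // /sz /unforced_size Fa5 // flag4.
rewrite wp_seq; apply: (@wp_bucketize _ _ _ sz) => //; rewrite ?k6.
- lia.
- lia.
- by move=> c ck; rewrite szE //; lia.
- move=> c ck; rewrite /sz /unforced_size; case: ifP => _; first by lia.
  apply: leq_ltn_trans n_lt_T.
  by rewrite size_filter -[leqRHS](size_iota 0) count_rev count_size.
- by move=> c cT; rewrite Fa6 // Fa5 // Fa4 // Fa3 // Fa2 // Fa1 // zero.
move=> b7 [Fa7 Fr7 [Fp7 Fo7]] H7 N7 c7.
rewrite wp_seq; apply: (@wp_collect W T n n_lt_T words sz k).
- by rewrite Fr7 // Fr6 // Fr5 // Fr4 // Fr3 // Fr2 // Fr1.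
- lia.
- by move=> z zT; rewrite H7 // k6.
- by move=> c ck; rewrite N7 // k6.
move=> b8 [Fa8 Fr8 [Fp8 Fo8]] cnt8 list8 c8.
have lab8 x : x < n -> aarr b8 LAB x = lab x.
  by move=> xn; rewrite Fa8 // Fa7 // Fa6 // Fa5 // Fa4.
have k8 : areg b8 rNumC = k by rewrite Fr8 // Fr7.
have n8 : areg b8 rNumV = n.
  by rewrite Fr8 // Fr7 // Fr6 // Fr5 // Fr4 // Fr3 // Fr2 // Fr1.
have prep : forall b, aarr b = aarr b8 ->
    (forall x, x \notin [:: rLAB; rFLAG] -> areg b x = areg b8 x) ->
    areg b rLAB = areg b (array_reg LAB) ->
    areg b rFLAG = areg b (array_reg FLAG) ->
  prepared n (m + m) src dst R lab k b.
  move=> b ab rb rl rf; split; rewrite ?ab //.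
  - by split=> //; rewrite rb.
  - move=> c ck; rewrite Fa8 // Fa7 // Fa6 // Fa5 // flag4 //; lia.
  - by move=> c cn; rewrite Fa8 // Fa7 // Fa6 // H5 //; lia.
  - by move=> x xn; rewrite Fa8 // Fa7 // Fa6 // N5.
  - by rewrite rb.
have p8 : apending b8 = apending a by rewrite Fp8 Fp7 Fp6 Fp5 Fp4 Fp3 Fp2.
have o8 : aouts b8 = aouts a by rewrite Fo8 Fo7 Fo6 Fo5 Fo4 Fo3 Fo2.
have {}c8 : aclock b8 <= aclock a + 90 + 600 * (n + m).
  have M1 : areg b1 rNumArcs = m + m by rewrite Fr1.
  have M3 : areg b3 rNumArcs = m + m by rewrite Fr3 // Fr2.
  have N4 : areg b4 rNumV = n by rewrite Fr4 // Fr3 // Fr2 // Fr1.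
  by move: c2 c4 c5 c7; rewrite ?M1 ?M3 ?N4 ?k6; lia.
case: b8 {Fa8 Fr8 Fp8 Fo8 cnt8 list8 lab8 k8 n8} prep p8 o8 c8
  => r8 m8 t8 p8 o8 prep /= pE oE c8.
split_safe; apply: (post _ lab k) => //=; last by lia.
by apply: prep => //; frame.
Qed.
End Preprocess.

(** * Address setup *)

Definition bases (a l : nat) : cmd :=
  foldr (fun j => Seq (Assign (array_reg j.+1)
                         (Add (Reg (array_reg j)) (Reg rLength))))
    Skip (iota a l).

Definition setup : cmd :=
  Seq (Assign rNumV (Read (Cst 0)))
 (Seq (Assign rNumE (Read (Cst 1)))
 (Seq (Assign rNumArcs (Add (Reg rNumE) (Reg rNumE)))
 (Seq (Assign rLength (Add (Add (Reg rNumV) (Add (Reg rNumArcs) (Reg rNumE))) (Cst 2)))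
      (bases 0 narrays)))).

Lemma eq_array_reg i j : (array_reg i == array_reg j) = (i == j).
Proof. by []. Qed.

(** Base addresses are obtained by repeated addition, since the machine does
not multiply. *)
Lemma exec_bases W S T a l s :
    regs s rLength = T -> (forall j, j <= a -> regs s (array_reg j) = j * T) ->
    (a + l) * T < W ->
  exists2 s', exec W S (bases a l) s s' &
    [/\ forall x, x < 20 -> regs s' x = regs s x,
        forall j, j <= a + l -> regs s' (array_reg j) = j * T,
        mem s' = mem s,
        clock s' = clock s + (4 * l + 1)
      & pending s' = pending s /\ outs s' = outs s].
Proof.
elim: l a s => [|l IH] a s sT sB lt_W.
  exists (tick 1 s); first by constructor.
  by split=> //= j; rewrite addn0; apply: sB.
have aW : a.+1 * T < W.
  by apply: leq_ltn_trans lt_W; rewrite leq_mul2r; lia.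
pose s1 := set_reg (array_reg a.+1) (a.+1 * T) (tick 4 s).
have ex1 : exec W S (Assign (array_reg a.+1) (Add (Reg (array_reg a)) (Reg rLength))) s s1.
  by constructor; rewrite /= sB // sT /word addnC -mulSn aW.
have [||| s2 ex2 [r2 b2 m2 c2 io2]] := IH a.+1 s1.
- by [].
- move=> j ja; rewrite [LHS]/= eq_array_reg.
  by case: eqP => [-> //|ne]; apply: sB; lia.
- by rewrite addSnnS.
exists s2; first exact: ExSeq ex1 ex2.
split=> //; last by rewrite c2 /=; lia.
- move=> x x20; rewrite r2 //= ifF //.
  by apply/eqP=> xE; move: x20; rewrite xE /array_reg; lia.
- by move=> j jl; rewrite b2 // addSnnS.
Qed.

Lemma exec_setup W S n m T s :
    T = n + (m + m + m) + 2 -> narrays * T < W -> 1 < S ->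
    mem s 0 = n -> mem s 1 = m -> regs s (array_reg 0) = 0 ->
  exists2 s', exec W S setup s s' &
    [/\ [/\ regs s' rNumV = n, regs s' rNumE = m & regs s' rNumArcs = m + m],
        forall j, j < narrays -> regs s' (array_reg j) = j * T,
        mem s' = mem s,
        clock s' <= clock s + 79
      & pending s' = pending s /\ outs s' = outs s].
Proof.
move=> TE TW S1 s0 s1 r0.
have W2 : 2 < W by lia.
pose t1 := set_reg rNumV n (tick 3 s).
have e1 : exec W S (Assign rNumV (Read (Cst 0))) s t1.
  by constructor; rewrite /= /word ifT ?ifT ?s0 //; lia.
pose t2 := set_reg rNumE m (tick 3 t1).
have e2 : exec W S (Assign rNumE (Read (Cst 1))) t1 t2.
  by constructor; rewrite /= /word ifT ?S1 ?s1 //; lia.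
pose t3 := set_reg rNumArcs (m + m) (tick 4 t2).
have e3 : exec W S (Assign rNumArcs (Add (Reg rNumE) (Reg rNumE))) t2 t3.
  by constructor; rewrite /= /word ifT //; lia.
pose t4 := set_reg rLength T (tick 8 t3).
have e4 : exec W S (Assign rLength (Add (Add (Reg rNumV) (Add (Reg rNumArcs) (Reg rNumE)))
                                   (Cst 2))) t3 t4.
  constructor; rewrite /= /word ifT; last by lia.
  rewrite (_ : n + (m + m + m) < W) ?W2; last by lia.
  by rewrite TE ifT //; lia.
have [||| s' e5 [r5 b5 m5 c5 [p5 o5]]] := @exec_bases W S T 0 narrays t4.
- by [].
- by case=> // _; rewrite mul0n -r0.
- by rewrite add0n.
exists s'; first exact: ExSeq e1 (ExSeq e2 (ExSeq e3 (ExSeq e4 e5))).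
split=> //.
- by rewrite !r5.
- by move=> j jJ; apply: b5; lia.
- by rewrite c5 /=; lia.
Qed.

Lemma all2_map_map (S X Y : Type) (r : X -> Y -> bool) (f : S -> X) (g : S -> Y) s :
  all2 r (map f s) (map g s) = all (fun x => r (f x) (g x)) s.
Proof. by elim: s => //= x s ->. Qed.

Lemma all2_theta_sub (I U : eqType) (f : I -> nat) (g : U -> nat) (h : I -> U) c c' s ds :
    c <= c' -> {in s, forall x, g (h x) = f x} ->
  all2 (fun x d => theta c (f x) d) s ds ->
  all2 (fun y d => theta c' (g y) d) (map h s) ds.
Proof.
move=> cc; elim: s ds => [|x s IH] [|d ds] //= gh /andP[/andP[t1 t2] ?].
rewrite IH ?andbT //; last by move=> y ys; rewrite gh // inE ys orbT.
rewrite /theta gh ?mem_head //; apply/andP; split.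
  by apply: leq_trans t1 _; rewrite leq_mul2r cc orbT.
by apply: leq_trans t2 _; rewrite leq_mul2r cc orbT.
Qed.

Lemma size_flatten_blocks (s : seq (seq nat)) :
  (forall B, B \in s -> size B <= 2) ->
  size (flatten [seq size B :: B | B <- s]) <= size s + size s + size s.
Proof.
elim: s => //= B s IH szB; rewrite size_cat.
have B2 : size B <= 2 by apply: szB; rewrite mem_head.
have : size (flatten [seq size B' :: B' | B' <- s]) <= size s + size s + size s.
  by apply: IH => B' Bs; apply: szB; rewrite inE Bs orbT.
by lia.
Qed.

(** * Instances, labels and delays *)

Section Instance.
Variables (V : finType) (H : seq (seq V)).
Hypotheses (normal : normalized H) (rank2 : rank H <= 2).

Let n := #|V|.
Let m := size H.
Let index_of (v : V) : nat := val (enum_rank v).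
Let blocks := [seq [seq index_of v | v <- A] | A <- H].

Lemma index_lt v : index_of v < n.
Proof. exact: ltn_ord. Qed.

Lemma index_inj : injective index_of.
Proof. by move=> u v /val_inj /enum_rank_inj. Qed.

Lemma index_onto x : x < n -> exists v, index_of v = x.
Proof.
move=> xn; exists (enum_val (Ordinal xn)).
by rewrite /index_of enum_valK.
Qed.

Lemma map_index_enum : [seq index_of v | v <- enum V] = iota 0 n.
Proof.
apply: (@eq_from_nth _ 0); rewrite size_map ?size_iota -cardE // => i i_lt.
rewrite nth_iota // (nth_map (enum_val (Ordinal i_lt))) -?cardE //.
by rewrite -[i in nth _ _ i]/(val (Ordinal i_lt)) -enum_val_nth /index_of enum_valK.
Qed.

Lemma encodeE : encode H =
  [:: n; m] ++ flatten [seq size B :: B | B <- blocks].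
Proof.
rewrite /encode -map_comp; congr (_ ++ flatten _).
by apply: eq_map => A /=; rewrite size_map.
Qed.

Lemma card_edges : #|edges H| = m.
Proof.
have /and3P[_ u _] := normal.
rewrite /edges cardsE; have /card_uniqP -> := u.
by rewrite size_map.
Qed.

Lemma input_size_ge : n + m <= input_size H.
Proof. by rewrite /input_size card_edges leq_addr. Qed.

Lemma edge_in A : A \in H -> [set x in A] \in edges H.
Proof. by move=> AH; rewrite inE; apply: map_f. Qed.

Lemma edge_of E : E \in edges H -> exists2 A, A \in H & E = [set x in A].
Proof. by rewrite inE => /mapP[A AH ->]; exists A. Qed.

Lemma edge_uniq A : A \in H -> uniq A.
Proof. by have /and3P[/allP u _ _] := normal => /u. Qed.

Lemma edge_size A : A \in H -> 0 < size A <= 2.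
Proof.
move=> AH; have /and3P[_ _ N] := normal.
have := card_edge rank2 (edge_in AH).
rewrite cardsE; have /card_uniqP -> := edge_uniq AH => ->.
by rewrite andbT lt0n; apply: contraNneq N => /size0nil <-.
Qed.

Lemma edge_shape A : A \in H ->
  (exists v, A = [:: v]) \/ (exists u v, A = [:: u; v] /\ graph H u v).
Proof.
move=> AH; move: (edge_size AH) (edge_uniq AH) (edge_in AH).
case: A {AH} => [|u [|v [|? ?]]] //= _.
  by move=> _ _; left; exists u.
rewrite andbT inE => uv E; right; exists u, v; split=> //; rewrite /graph uv.
by congr (_ \in edges H): E; apply/setP=> x; rewrite !inE.
Qed.

Lemma block_size B : B \in blocks -> 0 < size B <= 2.
Proof. by case/mapP=> A AH ->; rewrite size_map; apply: edge_size. Qed.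

Lemma block_lt B x : B \in blocks -> x \in B -> x < n.
Proof. by case/mapP=> A AH -> /mapP[v _ ->]; apply: index_lt. Qed.

(** Connection in the graph, transported to vertex indices.  The first
alternative makes the relation reflexive on all natural numbers. *)
Definition connected_index (x y : nat) : Prop :=
  x = y \/ exists u v, [/\ index_of u = x, index_of v = y & connect (graph H) u v].

Lemma connected_index_sym x y : connected_index x y -> connected_index y x.
Proof.
case=> [->|[u [v [ux vy uv]]]]; first by left.
by right; exists v, u; rewrite (sym_connect_sym (graph_sym H)).
Qed.

Lemma connected_index_trans x y z :
  connected_index x y -> connected_index y z -> connected_index x z.
Proof.
case=> [->//|[u [v [ux vy uv]]]]; case=> [<-|[v' [w [vy' wz vw]]]].
  by right; exists u, v.
right; exists u, w; split=> //; apply: connect_trans uv _.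
by have -> : v = v' by apply: index_inj; rewrite vy vy'.
Qed.

Lemma connected_index_block B : B \in blocks ->
  connected_index (head 0 B) (last 0 B).
Proof.
case/mapP=> A /edge_shape[[v ->] ->|[u [v [-> uv]] ->]]; first by left.
by right; exists u, v; split=> //; apply: connect1.
Qed.

Let src i := if i < size blocks then head 0 (nth [::] blocks i)
             else last 0 (nth [::] blocks (i - size blocks)).
Let dst i := if i < size blocks then last 0 (nth [::] blocks i)
             else head 0 (nth [::] blocks (i - size blocks)).
Let M := size blocks + size blocks.

Lemma block_nth A : A \in H ->
  exists2 j, j < M & src j = head 0 (map index_of A) /\ dst j = last 0 (map index_of A).
Proof.
move=> AH; set B := map index_of A.
have BH : B \in blocks by apply: map_f.
have i_lt : index B blocks < size blocks by rewrite index_mem.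
exists (index B blocks); first by rewrite /M; lia.
by rewrite /src /dst i_lt nth_index.
Qed.

Lemma graph_edge u v : graph H u v ->
  exists2 j, j < M & (src j = index_of u /\ dst j = index_of v) \/
                     (src j = index_of v /\ dst j = index_of u).
Proof.
case/andP=> uv /edge_of[A AH E]; have [j jM []] := block_nth AH.
have mA x : (x \in A) = (x == u) || (x == v).
  by move/setP/(_ x): E; rewrite !inE.
move: (edge_size AH) mA; case: A {AH E} => [|a [|b [|? ?]]] //= _ mA sj dj;
  exists j => //; rewrite sj dj.
  have := mA u; have := mA v; rewrite !inE !eqxx orbT => /eqP va /eqP ua.
  by rewrite ua va eqxx in uv.
have := mA u; have := mA v; have := mA a; have := mA b.
rewrite !inE !eqxx ?orbT /= => /esym/orP[]/eqP-> /esym/orP[]/eqP->; auto.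
- by rewrite orbb eq_sym (negPf uv) => /esym.
- by rewrite !orbb (negPf uv) => _ /esym.
Qed.

Lemma singleton_edge v : [set v] \in edges H ->
  exists2 j, j < M & src j = index_of v /\ dst j = index_of v.
Proof.
case/edge_of=> A AH E; have [j jM []] := block_nth AH.
have : size A = 1.
  by have /card_uniqP <- := edge_uniq AH; rewrite -cardsE -E cards1.
case: A {AH} E => [|a [|]] // E _ /= sj dj; exists j => //.
by rewrite sj dj; move/setP/(_ v): E; rewrite !inE eqxx => /esym/eqP->.
Qed.

Lemma loop_edge j v : j < M -> src j = dst j -> src j = index_of v ->
  [set v] \in edges H.
Proof.
move=> jM sd sv.
pose i := if j < size blocks then j else j - size blocks.
have i_lt : i < size blocks by rewrite /i; case: ifP; rewrite /M in jM; lia.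
have hl : head 0 (nth [::] blocks i) = index_of v /\
          last 0 (nth [::] blocks i) = index_of v.
  by rewrite /i; move: sd sv; rewrite /src /dst; case: ifP => _ <- ->.
move: hl; rewrite size_map in i_lt; rewrite (nth_map [::]) //.
have AH : nth [::] H i \in H by apply: mem_nth.
case: (edge_shape AH) (edge_in AH) => [[a ->]|[a [b [-> ab]]]] E /= [ha hb].
  rewrite -(index_inj ha) (_ : [set a] = [set x in [:: a]]) //.
  by apply/setP=> x; rewrite !inE.
by case/andP: ab; rewrite (index_inj ha) (index_inj hb) eqxx.
Qed.

Section Labelled.
Variables (lab : nat -> nat) (k : nat).
Hypotheses
  (k_le : k <= n)
  (lab_lt : forall x, x < n -> lab x < k)
  (lab_onto : forall c, c < k -> exists2 x, x < n & lab x = c)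
  (lab_conn : forall x y, x < n -> y < n -> lab x = lab y -> connected_index x y)
  (lab_edge : forall j, j < M -> lab (dst j) = lab (src j)).

(** Equal labels imply connection by the choice of [connected_index] as the
relation preserved by the search; the converse follows a path arc by arc. *)
Lemma label_connect u v :
  (lab (index_of u) == lab (index_of v)) = connect (graph H) u v.
Proof.
apply/eqP/idP => [E|/connectP[p + ->]].
  have [/index_inj->|[u' [v' [/index_inj-> /index_inj-> //]]]] :=
    lab_conn (index_lt u) (index_lt v) E.
  exact: connect0.
elim: p u => //= w p IH u /andP[uw wp]; rewrite -IH //.
have [j jM] := graph_edge uw; have := lab_edge jM.
by move=> E [] [su dw]; move: E; rewrite su dw.
Qed.

Definition label_class (c : nat) : {set V} := [set v | lab (index_of v) == c].

Lemma label_class_inj : {in gtn k &, injective label_class}.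
Proof.
move=> c d /= ck _ E; have [x xn lx] := lab_onto ck.
have [v vx] := index_onto xn.
have : v \in label_class c by rewrite inE vx lx.
by rewrite E inE vx lx => /eqP.
Qed.

Lemma label_componentsP C :
  reflect (exists2 c, c < k & C = label_class c) (C \in components H).
Proof.
have classE v : [set y | connect (graph H) v y] = label_class (lab (index_of v)).
  by apply/setP=> y; rewrite !inE eq_sym label_connect.
apply: (iffP (componentsP H C)) => [[v ->]|[c ck ->]].
  by exists (lab (index_of v)); rewrite ?classE // lab_lt ?index_lt.
have [x xn lx] := lab_onto ck; have [v vx] := index_onto xn.
by exists v; rewrite classE vx lx.
Qed.

Lemma card_components : #|components H| = k.
Proof.
have -> : components H = [set label_class (val c) | c : 'I_k].
  apply/setP=> C; apply/label_componentsP/imsetP => [[c ck ->]|[c _ ->]].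
    by exists (Ordinal ck).
  by exists (val c) => //; apply: ltn_ord.
rewrite card_in_imset ?card_ord // => c d _ _ E.
by apply/val_inj; apply: label_class_inj E; rewrite inE ltn_ord.
Qed.

Lemma label_class_index c :
  perm_eq (chain lab c n) [seq index_of v | v <- enum (label_class c)].
Proof.
apply: uniq_perm; first exact: chain_uniq.
  by rewrite map_inj_uniq ?enum_uniq //; apply: index_inj.
move=> x; rewrite mem_chain; apply/andP/mapP => [[xn lx]|[v + ->]].
  have [v vx] := index_onto xn.
  by exists v; rewrite ?vx // mem_enum inE vx.
by rewrite mem_enum inE index_lt.
Qed.

Lemma card_label_class c : #|label_class c| = size (chain lab c n).
Proof. by rewrite (perm_size (label_class_index c)) size_map -cardE. Qed.

Lemma forced_label c :
  forced H (label_class c) = has (loop_at src dst lab c) (iota 0 M).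
Proof.
apply/exists_inP/hasP => [[v]|[j]].
  rewrite inE => vc /singleton_edge[j jM [sj dj]].
  by exists j; rewrite ?mem_iota // /loop_at sj dj eqxx.
rewrite mem_iota => /= jM /andP[/eqP sd lc].
have sn : src j < n.
  exact: (arc_src_lt block_size block_lt jM).
have [v vj] := index_onto sn.
exists v; first by rewrite inE vj.
exact: loop_edge jM sd (esym vj).
Qed.

Let cs := buckets (unforced_size n M src dst lab) k 1 n.

(** An index is listed when its sort key is positive: this excludes exactly
the forced components, as every component has a vertex. *)
Lemma listedP c : reflect (c < k /\ ~~ forced H (label_class c)) (c \in cs).
Proof.
rewrite mem_buckets add1n ltnS /unforced_size -forced_label.
apply: (iffP andP) => [[ck]|[ck /negPf->]]; first by case: ifP.
split=> //; rewrite -card_label_class max_card andbT.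
have [x xn lx] := lab_onto ck; have [v vx] := index_onto xn.
by apply/card_gt0P; exists v; rewrite inE vx lx.
Qed.

Lemma listed_lt c : c \in cs -> c < k.
Proof. by case/listedP. Qed.

Lemma listed_size c : c \in cs ->
  unforced_size n M src dst lab c = #|label_class c|.
Proof.
by case/listedP=> _; rewrite /unforced_size -forced_label card_label_class => /negPf->.
Qed.

Lemma listed_uniq : uniq [seq label_class c | c <- cs].
Proof.
rewrite map_inj_in_uniq ?buckets_uniq // => c d /listed_lt ck /listed_lt dk.
exact: label_class_inj.
Qed.

Lemma listed_unforced : [seq label_class c | c <- cs] =i unforced_components H.
Proof.
move=> C; rewrite inE; apply/mapP/andP => [[c /listedP[ck nf] ->]|].
  by split=> //; apply/label_componentsP; exists c.
by case=> /label_componentsP[c ck ->] nf; exists c => //; apply/listedP.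
Qed.

Lemma sum_unforced (F : {set V} -> nat) :
  \sum_(C in unforced_components H) F C = \sum_(c <- cs) F (label_class c).
Proof.
rewrite -(big_map label_class predT F) big_uniq ?listed_uniq //=.
by apply: eq_bigl => C; rewrite listed_unforced.
Qed.

Lemma card_unforced : #|unforced_components H| = size cs.
Proof.
rewrite -(eq_card listed_unforced); have /card_uniqP -> := listed_uniq.
by rewrite size_map.
Qed.

Lemma listed_coatoms : [seq ~: label_class c | c <- cs] =i coatoms (horn_cnf H).
Proof.
move=> X; rewrite coatoms_unforced // (map_comp (@setC V)).
apply/mapP/imsetP => [[C]|[C CU ->]].
  by rewrite listed_unforced => CU ->; exists C.
by exists C; rewrite // listed_unforced.
Qed.

Lemma listed_sorted :
  sorted leq [seq #|~: X| | X <- [seq ~: label_class c | c <- cs]].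
Proof.
rewrite -map_comp (_ : map _ cs = map (unforced_size n M src dst lab) cs).
  exact: buckets_sorted.
by apply/eq_in_map => c c_in /=; rewrite setCK listed_size.
Qed.

Definition mode_word (md : mode) (c : nat) : seq nat :=
  match md with
  | SparseComplement => chain lab c n
  | CharVector => [seq nat_of_bool (lab x != c) | x <- iota 0 n]
  end.

Definition mode_size (md : mode) (c : nat) : nat :=
  match md with
  | SparseComplement => size (chain lab c n) + 1
  | CharVector => n
  end.

(** For characteristic vectors, a vertex belongs to the complement of the
component exactly when its label differs. *)
Lemma represents_word md c : represents md (~: label_class c) (mode_word md c).
Proof.
case: md => /=; first by rewrite setCK label_class_index.
rewrite -map_index_enum -map_comp; apply/eqP/eq_map => v /=.
by rewrite !inE.
Qed.

Lemma delay_order_size md c : delay_order md (~: label_class c) = mode_size md c.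
Proof. by case: md => //=; rewrite setCK card_label_class. Qed.

Lemma total_order_size md :
  total_order H md = input_size H + \sum_(c <- cs) mode_size md c.
Proof.
case: md => /=; last by rewrite card_unforced big_const_seq count_predT iter_addn_0 mulnC.
rewrite (sum_unforced (fun C => #|C| + 1)).
by under eq_bigr => c _ do rewrite card_label_class.
Qed.

Lemma enumerated_listed md by_size s1 s2 :
    pending s2 = [::] ->
    [seq o.2 | o <- outs s2] = [seq mode_word md c | c <- cs] ->
    all2 (fun c d => theta 80 (mode_size md c) d) cs
      (delays (clock s1) [seq o.1 | o <- outs s2]) ->
    clock s1 <= 700 * (input_size H).+1 ->
    clock s2 <= clock s1 + 6 + 80 * \sum_(c <- cs) mode_size md c ->
  enumerated H md by_size 1000 s1 s2.
Proof.
move=> pE oE dE c1 c2; exists [seq ~: label_class c | c <- cs].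
split.
- split; last exact: listed_coatoms.
  rewrite (map_comp (@setC V)) map_inj_uniq ?listed_uniq //.
  exact: setC_inj.
- by apply/implyP=> _; apply: listed_sorted.
- split=> //; rewrite oE all2_map_map; apply/allP=> c _.
  exact: represents_word.
- by apply: all2_theta_sub dE => // c _; apply: delay_order_size.
- rewrite total_order_size; lia.
Qed.
End Labelled.

Lemma size_encode_le : size (encode H) <= 2 + (m + m + m).
Proof.
have le2 B : B \in blocks -> size B <= 2 by move=> /block_size /andP[_ ->].
by rewrite encodeE /= !ltnS; have := size_flatten_blocks le2; rewrite size_map.
Qed.

Let W := word_bound H 11.
Let S := 1000 * (input_size H).+1.
Let T := n + (m + m + m) + 2.

(** Fifteen arrays of length [|V| + 3 |H| + 2] take linear space. *)
Lemma space_ge : narrays * T <= S.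
Proof. by have := input_size_ge; rewrite /S /T; lia. Qed.

(** One factor of the word bound is [L + 2], and the other ten exceed the
constant 1000, as 2 to the power 10 is 1024. *)
Lemma words_ge : S <= W.
Proof.
rewrite /S /W /word_bound expnS mulnC leq_mul //.
apply: (@leq_trans (2 ^ 10)) => //.
by rewrite leq_exp2r.
Qed.

Definition instance_prepared := prepared n M src dst connected_index.

(** The search is run with connection in the graph as the equivalence
relation to be respected. *)
Lemma exec_preprocess : exists s1 lab k b,
  [/\ exec W S (Seq setup preprocess) (init_state H) s1,
      refines narrays T b s1, instance_prepared lab k b,
      clock s1 <= 700 * (input_size H).+1
    & pending s1 = [::] /\ outs s1 = [::]].
Proof.
have SJ := space_ge; have SW := words_ge; have L_ge := input_size_ge.
have T2 : 2 <= T by rewrite /T; lia.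
have words : T + T + T < W by lia.
have TW : narrays * T < W.
  by apply: leq_trans SW; rewrite /S /T; lia.
have S1 : 1 < S by lia.
have mem0 : mem (init_state H) 0 = n.
    by rewrite -[LHS]/(nth 0 (encode H) 0) encodeE.
have mem1 : mem (init_state H) 1 = m.
    by rewrite -[LHS]/(nth 0 (encode H) 1) encodeE.
have [s0 ex0 [[rN0 rE0 rM0] base0 m0 c0 [p0 o0]]] :=
  @exec_setup W S n m T (init_state H) erefl TW S1 mem0 mem1 erefl.
pose a := AState (regs s0) (fun j i => mem s0 (j * T + i)) (clock s0)
            (pending s0) (outs s0).
have Ra : refines narrays T a s0 by split.
have mb : size blocks = m by rewrite size_map.
have T_ge : n + 3 * size blocks + 2 <= T by rewrite mb /T; lia.
pose post b := exists lab k, [/\ instance_prepared lab k b,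
  aclock b <= aclock a + 100 + 600 * (n + m), apending b = [::] & aouts b = [::]].
have : wp W narrays T preprocess post a.
  apply: (wp_preprocess block_size block_lt (fun x => or_introl erefl)
    connected_index_sym connected_index_trans connected_index_block T_ge words).
  - by rewrite mb.
  - move=> j i j0 iT; rewrite /= m0; apply: nth_default.
    apply: leq_trans size_encode_le _.
    have : T <= j * T by rewrite -[leqLHS]mul1n leq_mul2r j0 orbT.
    by rewrite /T; lia.
  - by move=> x xT; rewrite /= m0 -[LHS]/(nth 0 (encode H) (2 + x)) encodeE.
  - move=> b lab k prep pb ob cb; exists lab, k; split=> //.
    + by rewrite -mb.
    + by rewrite pb /= p0.
    + by rewrite ob /= o0.
move=> /(wp_sound SJ SW) /(_ Ra)[s1 ex1 [b R1 [lab [k [prep cb pb ob]]]]].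
have [_ c1 [p1 o1] _ _] := R1.
exists s1, lab, k, b; split=> //; first exact: ExSeq ex0 ex1.
  by move: cb c0; rewrite c1 /=; lia.
by rewrite p1 o1.
Qed.

Lemma prepared_components_computed s1 b lab k :
  refines narrays T b s1 -> instance_prepared lab k b ->
  components_computed H s1.
Proof.
move=> [Er _ _ Em Eb] P.
have k_le := prepared_k P; have lab_lt := prepared_lt P.
have lab_onto := prepared_onto P; have lab_conn := prepared_conn P.
have lab_edge := prepared_edge P.
have [rNumC' _ rL rF] := prepared_regs P.
have nT : n < T by rewrite /T; lia.
have labE v : mem s1 (regs s1 0 + enum_rank v) = lab (index_of v).
  rewrite Er rL Eb // Em //; first by apply: (prepared_lab P); apply: index_lt.
  by apply: ltn_trans nT; apply: index_lt.
split; rewrite ?Er ?rNumC'.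
- by rewrite (card_components lab_lt lab_onto lab_conn lab_edge).
- by move=> v; rewrite -Er labE; apply: lab_lt; apply: index_lt.
- by move=> u v; rewrite -!Er !labE (label_connect lab_conn lab_edge).
- move=> C v /(label_componentsP lab_lt lab_onto lab_conn lab_edge)[c ck ->].
  rewrite inE => /eqP lc; rewrite -!Er labE lc Er rF Eb // Em //; last by lia.
  by rewrite (prepared_flag P) // forced_label.
Qed.

Lemma exec_enumerate s1 b lab k md by_size :
    refines narrays T b s1 -> instance_prepared lab k b ->
    clock s1 <= 700 * (input_size H).+1 -> pending s1 = [::] -> outs s1 = [::] ->
  exists2 s2, exec W W (enumerate md by_size) s1 s2 &
    enumerated H md by_size 1000 s1 s2.
Proof.
move=> R1 P c1 p1 o1.
have k_le := prepared_k P; have lab_lt := prepared_lt P.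
have lab_onto := prepared_onto P; have lab_conn := prepared_conn P.
have lab_edge := prepared_edge P.
have [rNumC' rNumV' _ _] := prepared_regs P.
have [rC listE] := prepared_list P.
have [_ cb [pb ob] _ _] := R1.
have SJ := space_ge; have SW := words_ge.
have nT : n < T by rewrite /T; lia.
have words : T + T + T < W.
  by apply: leq_trans SW; rewrite /S /T; have := input_size_ge; lia.
set cs := buckets (unforced_size n M src dst lab) k 1 n in rC listE.
have cs_lt c : c \in cs -> c < k by rewrite mem_buckets => /andP[].
pose post b' := [/\ apending b' = [::],
  [seq o.2 | o <- aouts b'] = [seq mode_word lab md c | c <- cs],
  all2 (fun c d => theta 80 (mode_size lab md c) d) cs
    (delays (aclock b) [seq o.1 | o <- aouts b'])
  & aclock b' <= aclock b + 6 + 80 * \sum_(c <- cs) mode_size lab md c].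
have : wp W narrays T (enumerate md by_size) post b.
  apply: (@wp_emit_all W T n nT words b cs _ (mode_word lab md) (mode_size lab md) 60).
  - case: md @post => _ /=.
      apply: (emits_component nT words cs_lt) => //; first by lia.
      + by move=> c ck; apply: (prepared_head P); lia.
      + exact: (prepared_next P).
    apply: (emits_vector nT words) => //.
    + exact: (prepared_lab P).
    + by move=> x /lab_lt; lia.
    + by move=> c /cs_lt; lia.
  - by move=> c /cs_lt ck; case: (md) => /=; lia.
  - exact: rC.
  - by apply: leq_ltn_trans (size_buckets _ _ _ _) _; lia.
  - exact: listE.
  - by rewrite -pb.
  - by rewrite -ob.
  - by move=> b' pb' wb' db' cb'; split.
move=> /(wp_sound (leq_trans SJ SW) (leqnn W)) /(_ R1).
case=> s2 ex2 [b2 [_ c2 [p2 o2] _ _] [pE oE dE cE]].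
exists s2 => //; apply: (@enumerated_listed lab k) => //.
- by rewrite p2.
- by rewrite o2.
- by rewrite o2 cb.
- by rewrite c2 cb.
Qed.
End Instance.

Theorem theorem5p3 :
  exists (pre : cmd) (enumerate : mode -> bool -> cmd) (k c : nat),
  forall (V : finType) (H : seq (seq V)),
    normalized H -> rank H <= 2 ->
    coatoms (horn_cnf H) = [set ~: C | C in unforced_components H] /\
    exists s1 : state,
      [/\ exec (word_bound H k) (c * (input_size H).+1) pre (init_state H) s1,
          clock s1 <= c * (input_size H).+1,
          components_computed H s1,
          outs s1 = [::] /\ pending s1 = [::]
        & forall (m : mode) (by_size : bool), exists s2 : state,
            exec (word_bound H k) (word_bound H k) (enumerate m by_size) s1 s2
            /\ enumerated H m by_size c s1 s2].
Proof.
(* The preprocessing takes at most 700 (L + 1) steps; 1000 leaves room for the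
   enumeration and also bounds the space and the delays. *)
exists (Seq setup preprocess), enumerate, 11, 1000 => V H normal rank2.
split; first exact: coatoms_unforced.
have [s1 [lab [k [b [ex1 R1 P c1 [p1 o1]]]]]] := exec_preprocess normal rank2.
exists s1; split=> //.
- by lia.
- exact: prepared_components_computed R1 P.
- move=> md by_size.
  have [s2 ex2 E2] := exec_enumerate normal rank2 md by_size R1 P c1 p1 o1.
  by exists s2.
Qed.
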